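(* Let $\theta\in\mathbb{R}$, and let $\mathcal{A}(S^4_\theta)$ and $\mathcal{A}(S^7_{\theta'})$ be the noncommutative $4$- and $7$-spheres, the latter with the action $w\mapsto\alpha_w$ of $SU(2)$ by $*$-automorphisms (all as defined in the context). Then the subalgebra of $SU(2)$-invariant elements $$\mathrm{Inv}_{SU(2)}(\mathcal{A}(S^7_{\theta'}))=\{a\in \mathcal{A}(S^7_{\theta'}) : \alpha_w(a)=a \text{ for all } w\in SU(2)\}$$ equals $\mathcal{A}(S^4_\theta)$; more precisely, the assignment $$\alpha\mapsto 2(z^1\bar z^3+z^2\bar z^4),\qquad \beta\mapsto 2(-z^1z^4+z^2z^3),\qquad x\mapsto z^1\bar z^1+z^2\bar z^2-z^3\bar z^3-z^4\bar z^4$$ defines an isomorphism of unital $*$-algebras from $\mathcal{A}(S^4_\theta)$ onto $\mathrm{Inv}_{SU(2)}(\mathcal{A}(S^7_{\theta'}))$.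
   Context: Let $\lambda=e^{2\pi i\theta}$ and $\mu=\sqrt{\lambda}=e^{\pi i\theta}$. $\mathcal{A}(S^4_\theta)$ is the unital complex $*$-algebra generated by $\alpha,\beta$ and a central $x=x^*$ with relations $\alpha\beta=\lambda\beta\alpha$, $\alpha\beta^*=\bar\lambda\beta^*\alpha$, $\alpha\alpha^*=\alpha^*\alpha$, $\beta\beta^*=\beta^*\beta$ and $\alpha\alpha^*+\beta\beta^*+x^2=1$. $\mathcal{A}(S^7_{\theta'})$ is the unital complex $*$-algebra generated by $z^1,\dots,z^4$ and their adjoints $\bar z^i=(z^i)^*$, with relations $z^iz^j=\lambda'^{ij}z^jz^i$, $\bar z^iz^j=\lambda'^{ji}z^j\bar z^i$, $\bar z^i\bar z^j=\lambda'^{ij}\bar z^j\bar z^i$ and $\sum_i z^i\bar z^i=1$, where $$(\lambda'^{ij})=\begin{pmatrix}1&1&\mu&\mu\\1&1&\mu&\mu\\\bar\mu&\bar\mu&1&1\\\bar\mu&\bar\mu&1&1\end{pmatrix},\quad\text{i.e. } \lambda'^{ij}=e^{2\pi i\theta'_{ij}},\quad \theta'=\frac{\theta}{2}\begin{pmatrix}0&0&1&1\\0&0&1&1\\-1&-1&0&0\\-1&-1&0&0\end{pmatrix}.$$ For $w=\begin{pmatrix}w^1&w^2\\-\bar w^2&\bar w^1\end{pmatrix}\in SU(2)$, $\alpha_w$ is the $*$-automorphism of $\mathcal{A}(S^7_{\theta'})$ given on generators by $(z^1,z^2,z^3,z^4)\mapsto(z^1,z^2,z^3,z^4)\begin{pmatrix}w&0\\0&w\end{pmatrix}$.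 *)

(* Defs.v *)
From HB Require Import structures.
From mathcomp Require Import all_boot all_order all_algebra.
From mathcomp Require Import all_classical reals topology normedtype trigo.
From mathcomp.real_closed Require Import complex.

Set Implicit Arguments.
Unset Strict Implicit.
Unset Printing Implicit Defensive.

Import Order.TTheory GRing.Theory Num.Theory.

Local Open Scope classical_set_scope.
Local Open Scope ring_scope.

HB.mixin Record isStarAlgebra (C : numClosedFieldType) A
    of GRing.Algebra C A := {
  star : A -> A;
  starK : involutive star;
  starD : {morph star : x y / x + y};
  starM : forall x y, star (x * y) = star y * star x;
  starZ : forall (c : C) x, star (c *: x) = c^* *: star x
}.

#[short(type="starAlgType")]
HB.structure Definition StarAlgebra (C : numClosedFieldType) :=
  {A of isStarAlgebra C A & GRing.Algebra C A}.

Arguments star {C A} x : rename.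

Section StarTheory.
Variables (C : numClosedFieldType) (A : starAlgType C).

Lemma star1 : star (1 : A) = 1.
Proof. by have := starM (1 : A) (star 1); rewrite mul1r starK mul1r. Qed.

Lemma star0 : star (0 : A) = 0.
Proof. by apply: (addrI (star (0 : A))); rewrite -starD !addr0. Qed.

Lemma star_sum I r (P : pred I) (F : I -> A) :
  star (\sum_(i <- r | P i) F i) = \sum_(i <- r | P i) star (F i).
Proof. by apply: (big_morph _ (@starD C A) star0). Qed.

End StarTheory.

HB.instance Definition _ (C : numClosedFieldType) :=
  @isStarAlgebra.Build C C^o (@Num.conj C) (@conjCK C) (rmorphD _)
    (fun x y => etrans (rmorphM _ x y) (mulrC _ _)) (rmorphM _).

(* Unital complex *-algebras presented by generators and relations: formal     *)
(* *-expressions modulo the least congruence containing the *-algebra axioms   *)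
(* and the relations [rel]. The constant [SConst c] stands for c times 1, and  *)
(* scaling by c for the product with [SConst c].                               *)

Inductive sterm (C G : Type) : Type :=
  | SGen of G
  | SConst of C
  | SAdd of sterm C G & sterm C G
  | SMul of sterm C G & sterm C G
  | SStar of sterm C G.

Arguments SGen {C G}.
Arguments SConst {C G}.

Declare Scope sterm_scope.
Delimit Scope sterm_scope with ST.
Bind Scope sterm_scope with sterm.
Notation "t + u" := (SAdd t u) : sterm_scope.
Notation "t * u" := (SMul t u) : sterm_scope.
Notation "t ^*" := (SStar t) : sterm_scope.
Notation "c %:S" := (SConst c%R) (at level 1, format "c %:S") : sterm_scope.

Inductive scongr (C : numClosedFieldType) (G : Type)
    (rel : sterm C G -> sterm C G -> Prop) : sterm C G -> sterm C G -> Prop :=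
  | sc_rel t u : rel t u -> scongr rel t u
  | sc_refl t : scongr rel t t
  | sc_sym t u : scongr rel t u -> scongr rel u t
  | sc_trans t u v : scongr rel t u -> scongr rel u v -> scongr rel t v
  | sc_add t t' u u' : scongr rel t t' -> scongr rel u u' ->
      scongr rel (t + u)%ST (t' + u')%ST
  | sc_mul t t' u u' : scongr rel t t' -> scongr rel u u' ->
      scongr rel (t * u)%ST (t' * u')%ST
  | sc_star t t' : scongr rel t t' -> scongr rel (t^*)%ST (t'^*)%ST
  | sc_addA t u v : scongr rel (t + (u + v))%ST (t + u + v)%ST
  | sc_addC t u : scongr rel (t + u)%ST (u + t)%ST
  | sc_add0 t : scongr rel (0%:S + t)%ST t
  | sc_addN t : scongr rel ((-1)%:S * t + t)%ST 0%:S%ST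
  | sc_mulA t u v : scongr rel (t * (u * v))%ST (t * u * v)%ST
  | sc_mul1 t : scongr rel (1%:S * t)%ST t
  | sc_mulDl t u v : scongr rel ((t + u) * v)%ST (t * v + u * v)%ST
  | sc_mulDr t u v : scongr rel (t * (u + v))%ST (t * u + t * v)%ST
  | sc_constD a b : scongr rel (a + b)%:S%ST (a%:S + b%:S)%ST
  | sc_constM a b : scongr rel (a * b)%:S%ST (a%:S * b%:S)%ST
  | sc_constC a t : scongr rel (a%:S * t)%ST (t * a%:S)%ST
  | sc_starK t : scongr rel (t^*^*)%ST t
  | sc_starD t u : scongr rel ((t + u)^*)%ST (t^* + u^*)%ST
  | sc_starM t u : scongr rel ((t * u)^*)%ST (u^* * t^*)%ST
  | sc_star_const (a : C) : scongr rel ((a%:S)^*)%ST (a^*)%:S%ST.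

Section Presented.
Variables (C : numClosedFieldType) (G : Type).
Variable rel : sterm C G -> sterm C G -> Prop.

Definition scongrb : {classic sterm C G} -> {classic sterm C G} -> bool :=
  fun t u => `[< scongr rel t u >].

Lemma scongrb_refl : reflexive scongrb.
Proof. by move=> t; apply/asboolP; apply: sc_refl. Qed.

Lemma scongrb_sym : symmetric scongrb.
Proof. by move=> t u; apply/asboolP/asboolP; apply: sc_sym. Qed.

Lemma scongrb_trans : transitive scongrb.
Proof.
by move=> u t v /asboolP tu /asboolP uv; apply/asboolP; apply: sc_trans tu uv.
Qed.

Definition scongr_equiv := EquivRel scongrb scongrb_refl scongrb_sym scongrb_trans.

Definition presented : Type := {eq_quot scongr_equiv}%qT.

HB.instance Definition _ := Choice.on presented.

Definition pclass (t : sterm C G) : presented :=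
  (\pi_({eq_quot scongr_equiv}%qT) (t : {classic sterm C G}))%qT.
Definition prepr (a : presented) : sterm C G :=
  repr (a : {eq_quot scongr_equiv}%qT).

Lemma preprK a : pclass (prepr a) = a.
Proof. exact: reprK. Qed.

Lemma pclassP t u : pclass t = pclass u <-> scongr rel t u.
Proof.
split; first by move=> /eqmodP/asboolP.
by move=> tu; apply/eqmodP/asboolP.
Qed.

Lemma pclassK t : scongr rel (prepr (pclass t)) t.
Proof. by apply/pclassP; rewrite preprK. Qed.

Lemma pclass_ind (P : presented -> Prop) : (forall t, P (pclass t)) -> forall a, P a.
Proof. by move=> Pt a; rewrite -[a]preprK. Qed.

Definition pgen (g : G) : presented := pclass (SGen g).
Definition padd a b := pclass (prepr a + prepr b)%ST.
Definition pmul a b := pclass (prepr a * prepr b)%ST.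
Definition popp a := pclass ((-1)%:S * prepr a)%ST.
Definition pscale (c : C) a := pclass (c%:S * prepr a)%ST.
Definition pstar a := pclass ((prepr a)^*)%ST.

Lemma paddE t u : padd (pclass t) (pclass u) = pclass (t + u)%ST.
Proof. by apply/pclassP/sc_add; apply: pclassK. Qed.
Lemma pmulE t u : pmul (pclass t) (pclass u) = pclass (t * u)%ST.
Proof. by apply/pclassP/sc_mul; apply: pclassK. Qed.
Lemma poppE t : popp (pclass t) = pclass ((-1)%:S * t)%ST.
Proof. by apply/pclassP/sc_mul; [apply: sc_refl|apply: pclassK]. Qed.
Lemma pscaleE c t : pscale c (pclass t) = pclass (c%:S * t)%ST.
Proof. by apply/pclassP/sc_mul; [apply: sc_refl|apply: pclassK]. Qed.
Lemma pstarE t : pstar (pclass t) = pclass (t^*)%ST.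
Proof. by apply/pclassP/sc_star; apply: pclassK. Qed.

Let pE := (paddE, pmulE, poppE, pscaleE, pstarE).

Fact padd_addA : associative padd.
Proof.
elim/pclass_ind => t; elim/pclass_ind => u; elim/pclass_ind => v.
by rewrite !pE; apply/pclassP/sc_addA.
Qed.
Fact padd_addC : commutative padd.
Proof.
elim/pclass_ind => t; elim/pclass_ind => u.
by rewrite !pE; apply/pclassP/sc_addC.
Qed.
Fact padd_add0 : left_id (pclass 0%:S%ST) padd.
Proof. by elim/pclass_ind => t; rewrite !pE; apply/pclassP/sc_add0. Qed.
Fact padd_addN : left_inverse (pclass 0%:S%ST) popp padd.
Proof. by elim/pclass_ind => t; rewrite !pE; apply/pclassP/sc_addN. Qed.

HB.instance Definition _ := GRing.isZmodule.Build presented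
  padd_addA padd_addC padd_add0 padd_addN.

Fact pmul_mulA : associative pmul.
Proof.
elim/pclass_ind => t; elim/pclass_ind => u; elim/pclass_ind => v.
by rewrite !pE; apply/pclassP/sc_mulA.
Qed.
Fact pmul_mul1l : left_id (pclass 1%:S%ST) pmul.
Proof. by elim/pclass_ind => t; rewrite !pE; apply/pclassP/sc_mul1. Qed.
Fact pmul_mul1r : right_id (pclass 1%:S%ST) pmul.
Proof.
elim/pclass_ind => t; rewrite !pE; apply/pclassP.
exact: sc_trans (sc_sym (sc_constC _ _ _)) (sc_mul1 _ _).
Qed.
Fact pmul_mulDl : left_distributive pmul padd.
Proof.
elim/pclass_ind => t; elim/pclass_ind => u; elim/pclass_ind => v.
by rewrite !pE; apply/pclassP/sc_mulDl.
Qed.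
Fact pmul_mulDr : right_distributive pmul padd.
Proof.
elim/pclass_ind => t; elim/pclass_ind => u; elim/pclass_ind => v.
by rewrite !pE; apply/pclassP/sc_mulDr.
Qed.

HB.instance Definition _ := GRing.Zmodule_isPzRing.Build presented
  pmul_mulA pmul_mul1l pmul_mul1r pmul_mulDl pmul_mulDr.

Fact pscale_scaleA a b v : pscale a (pscale b v) = pscale (a * b) v.
Proof.
elim/pclass_ind: v => t; rewrite !pE; apply/pclassP.
apply: sc_trans (sc_mulA _ _ _ _) _; apply: sc_mul (sc_refl _ _).
exact: sc_sym (sc_constM _ _ _).
Qed.
Fact pscale_scale1 : left_id 1 pscale.
Proof. by elim/pclass_ind => t; rewrite !pE; apply/pclassP/sc_mul1. Qed.
Fact pscale_scaleDr : right_distributive pscale +%R.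
Proof.
move=> c; elim/pclass_ind => t; elim/pclass_ind => u.
by rewrite /GRing.add /= !pE; apply/pclassP/sc_mulDr.
Qed.
Fact pscale_scaleDl v : {morph pscale^~ v : a b / a + b}.
Proof.
move=> a b; elim/pclass_ind: v => t.
rewrite [in RHS]/GRing.add /= !pE; apply/pclassP.
apply: sc_trans (sc_mulDl _ _ _ _); apply: sc_mul (sc_refl _ _).
exact: sc_constD.
Qed.

HB.instance Definition _ := GRing.Zmodule_isLmodule.Build C presented
  pscale_scaleA pscale_scale1 pscale_scaleDr pscale_scaleDl.

Lemma pclassD t u : pclass (t + u)%ST = pclass t + pclass u.
Proof. by rewrite -paddE. Qed.
Lemma pclassM t u : pclass (t * u)%ST = pclass t * pclass u.
Proof. by rewrite -pmulE. Qed.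
Lemma pclass1 : pclass 1%:S%ST = 1.
Proof. by []. Qed.
Lemma pclassC c : pclass c%:S%ST = c *: (1 : presented).
Proof.
rewrite -pclass1 [RHS]pscaleE; apply/pclassP.
by have := sc_constM rel c 1; rewrite mulr1.
Qed.
Lemma pclassS t : pclass (t^*)%ST = pstar (pclass t).
Proof. by rewrite pstarE. Qed.

Fact presented_scalerAl (c : C) (a b : presented) : c *: (a * b) = (c *: a) * b.
Proof.
elim/pclass_ind: a => t; elim/pclass_ind: b => u.
by rewrite /GRing.scale /GRing.mul /= !pE; apply/pclassP/sc_mulA.
Qed.
Fact presented_scalerAr (c : C) (a b : presented) : c *: (a * b) = a * (c *: b).
Proof.
elim/pclass_ind: a => t; elim/pclass_ind: b => u.
rewrite /GRing.scale /GRing.mul /= !pE; apply/pclassP.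
apply: sc_trans (sc_mulA _ _ _ _) _; apply: sc_trans (sc_sym (sc_mulA _ _ _ _)).
exact: sc_mul (sc_constC _ _ _) (sc_refl _ _).
Qed.

Fact pstarK : involutive pstar.
Proof. by elim/pclass_ind => t; rewrite !pE; apply/pclassP/sc_starK. Qed.
Fact pstarD : {morph pstar : a b / a + b}.
Proof.
elim/pclass_ind => t; elim/pclass_ind => u.
by rewrite /GRing.add /= !pE; apply/pclassP/sc_starD.
Qed.
Fact pstarM (a b : presented) : pstar (a * b) = pstar b * pstar a.
Proof.
elim/pclass_ind: a => t; elim/pclass_ind: b => u.
by rewrite /GRing.mul /= !pE; apply/pclassP/sc_starM.
Qed.
Fact pstarZ (c : C) (a : presented) : pstar (c *: a) = c^* *: pstar a.
Proof.
elim/pclass_ind: a => t; rewrite /GRing.scale /= !pE; apply/pclassP.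
apply: sc_trans (sc_starM _ _ _) _; apply: sc_trans (sc_sym (sc_constC _ _ _)).
exact: sc_mul (sc_refl _ _) (sc_star_const _ _).
Qed.

End Presented.

Arguments pgen {C G rel} g.

(* Evaluation of formal *-expressions and the universal property.              *)

Section Lift.
Variables (C : numClosedFieldType) (G : Type).
Variable rel : sterm C G -> sterm C G -> Prop.
Variables (A : starAlgType C) (f : G -> A).

Fixpoint seval (t : sterm C G) : A :=
  match t with
  | SGen g => f g
  | SConst c => c%:A
  | SAdd t u => seval t + seval u
  | SMul t u => seval t * seval u
  | SStar t => star (seval t)
  end.

Definition srespects := forall t u, rel t u -> seval t = seval u.

(* The *-homomorphism induced by the assignment [f] on generators; meaningful  *)
(* only if [f] respects the relations.                                         *)
Definition plift (a : presented rel) : A := seval (prepr a).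

Hypothesis frel : srespects.

Lemma scongr_seval t u : scongr rel t u -> seval t = seval u.
Proof.
elim=> {t u} //=.
- by move=> t u v _ -> _ ->.
- by move=> t t' u u' _ -> _ ->.
- by move=> t t' u u' _ -> _ ->.
- by move=> t t' _ ->.
- by move=> t u v; rewrite addrA.
- by move=> t u; rewrite addrC.
- by move=> t; rewrite scale0r add0r.
- by move=> t; rewrite -scalerAl mul1r scaleN1r addNr scale0r.
- by move=> t u v; rewrite mulrA.
- by move=> t; rewrite scale1r mul1r.
- by move=> t u v; rewrite mulrDl.
- by move=> t u v; rewrite mulrDr.
- by move=> a b; rewrite scalerDl.
- by move=> a b; rewrite -scalerAl mul1r scalerA.
- by move=> a t; rewrite -scalerAl -scalerAr mul1r mulr1.
- by move=> t; rewrite starK.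
- by move=> t u; rewrite starD.
- by move=> t u; rewrite starM.
- by move=> a; rewrite starZ star1.
Qed.

Lemma pliftE t : plift (pclass rel t) = seval t.
Proof. exact/scongr_seval/pclassK. Qed.
Lemma plift_gen g : plift (pgen g) = f g.
Proof. exact: pliftE. Qed.
Lemma pliftD : {morph plift : a b / a + b}.
Proof.
by elim/pclass_ind => t; elim/pclass_ind => u; rewrite -pclassD !pliftE.
Qed.
Lemma pliftM : {morph plift : a b / a * b}.
Proof.
by elim/pclass_ind => t; elim/pclass_ind => u; rewrite -pclassM !pliftE.
Qed.
Lemma plift1 : plift 1 = 1.
Proof. by rewrite -pclass1 pliftE /= scale1r. Qed.
Lemma pliftZ c a : plift (c *: a) = c *: plift a.
Proof.
rewrite -[in LHS](mul1r a) (presented_scalerAl c 1 a) -pclassC pliftM pliftE /=.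
by rewrite -scalerAl mul1r.
Qed.
Lemma plift_star a : plift (pstar a) = star (plift a).
Proof. by elim/pclass_ind: a => t; rewrite -pclassS !pliftE. Qed.

Lemma plift0 : plift 0 = 0.
Proof. by apply: (addrI (plift 0)); rewrite -pliftD !addr0. Qed.

Lemma presented_nontrivial : (1 : presented rel) != 0.
Proof.
by apply/eqP => /(congr1 plift)/eqP; rewrite plift1 plift0 oner_eq0.
Qed.

End Lift.

Arguments srespects {C G} rel {A} f.
Arguments plift {C G rel A} f a.

Definition expi (R : realType) (t : R) : R[i] := (cos t +i* sin t)%C.

Lemma sum_ord4 (V : zmodType) (F : 'I_4 -> V) :
  \sum_i F i = F 0 + F 1 + F 2 + F 3.
Proof.
rewrite !big_ord_recr big_ord0 /= add0r.
by do !congr (_ + _); congr F; apply: val_inj.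
Qed.

Section Spheres.
Variables (R : realType) (theta : R).
Local Notation C := R[i].

Definition lam : C := expi (2 * pi * theta).
Definition mu : C := expi (pi * theta).

Inductive S4gen := S4a | S4b | S4x.

Local Notation "''a'" := (SGen S4a) : sterm_scope.
Local Notation "''b'" := (SGen S4b) : sterm_scope.
Local Notation "''x'" := (SGen S4x) : sterm_scope.

Inductive S4rel : sterm C S4gen -> sterm C S4gen -> Prop :=
  | S4_x_central t : S4rel ('x * t)%ST (t * 'x)%ST
  | S4_x_self : S4rel ('x)%ST ('x^*)%ST
  | S4_ab : S4rel ('a * 'b)%ST (lam%:S * ('b * 'a))%ST
  | S4_abs : S4rel ('a * 'b^*)%ST ((lam^*)%:S * ('b^* * 'a))%ST
  | S4_a_normal : S4rel ('a * 'a^*)%ST ('a^* * 'a)%ST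
  | S4_b_normal : S4rel ('b * 'b^*)%ST ('b^* * 'b)%ST
  | S4_sphere : S4rel ('a * 'a^* + 'b * 'b^* + 'x * 'x)%ST 1%:S%ST.

Definition S4 : Type := presented S4rel.

(* The indices are shifted by one throughout: z^1, ..., z^4 are numbered by    *)
(* 'I_4, which is convertible to 'I_(2 + 2).                                   *)
Definition lam' : 'M[C]_(2 + 2) :=
  block_mx (const_mx 1) (const_mx mu) (const_mx mu^*) (const_mx 1).

Local Notation "''z_' i" := (SGen i) (at level 1, i at level 0) : sterm_scope.

Inductive S7rel : sterm C 'I_4 -> sterm C 'I_4 -> Prop :=
  | S7_zz i j : S7rel ('z_i * 'z_j)%ST ((lam' i j)%:S * ('z_j * 'z_i))%ST
  | S7_zsz i j : S7rel ('z_i^* * 'z_j)%ST ((lam' j i)%:S * ('z_j * 'z_i^*))%ST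
  | S7_zszs i j :
      S7rel ('z_i^* * 'z_j^*)%ST ((lam' i j)%:S * ('z_j^* * 'z_i^*))%ST
  | S7_sphere :
      S7rel ('z_0 * 'z_0^* + 'z_1 * 'z_1^* + 'z_2 * 'z_2^* + 'z_3 * 'z_3^*)%ST
            1%:S%ST.

Definition S7 : Type := presented S7rel.

Fact S4_nontrivial : (1 : presented S4rel) != 0.
Proof.
apply: (@presented_nontrivial C S4gen S4rel C^o
  (fun g => if g is S4x then 1 else 0)).
move=> t u; case=> //=; rewrite /star /=
  ?rmorph0 ?rmorph1 ?mulr0 ?mul0r ?mulr1 ?scaler0 //.
- by move=> v; rewrite mulr1 mul1r.
- by rewrite !add0r scale1r.
Qed.

HB.instance Definition _ := GRing.PzRing.on S4.
HB.instance Definition _ := GRing.Lmodule.on S4.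
HB.instance Definition _ := GRing.PzSemiRing_isNonZero.Build S4 S4_nontrivial.
HB.instance Definition _ := GRing.Lmodule_isLalgebra.Build C S4
  (@presented_scalerAl _ _ S4rel).
HB.instance Definition _ := GRing.Lalgebra_isAlgebra.Build C S4
  (@presented_scalerAr _ _ S4rel).
HB.instance Definition _ := isStarAlgebra.Build C S4 (@pstarK _ _ S4rel)
  (@pstarD _ _ S4rel) (@pstarM _ _ S4rel) (@pstarZ _ _ S4rel).

Definition S4alpha : S4 := pgen S4a.
Definition S4beta : S4 := pgen S4b.
Definition S4coord : S4 := pgen S4x.

Lemma S4_seval t :
  seval (fun g => pgen g : S4) t = pclass S4rel t.
Proof.
elim: t => [g|c|t IHt u IHu|t IHt u IHu|t IHt] //=.
- by rewrite pclassC.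
- by rewrite IHt IHu -pclassD.
- by rewrite IHt IHu -pclassM.
- by rewrite IHt pclassS.
Qed.

Lemma S4_hom_ext (A : starAlgType C) (f g : {lrmorphism S4 -> A}) :
  {morph f : a / star a} -> {morph g : a / star a} ->
  f S4alpha = g S4alpha -> f S4beta = g S4beta -> f S4coord = g S4coord ->
  f =1 g.
Proof.
move=> fS gS fga fgb fgx; elim/pclass_ind => t; rewrite -S4_seval.
elim: t => [[]|c|t IHt u IHu|t IHt u IHu|t IHt] //=.
- by rewrite !linearZ /= !rmorph1.
- by rewrite !rmorphD /= IHt IHu.
- by rewrite !rmorphM /= IHt IHu.
- by rewrite fS gS IHt.
Qed.

Lemma lam'E (i j : 'I_4) : lam' i j =
  if (i < 2)%N then if (j < 2)%N then 1 else mu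
  else if (j < 2)%N then mu^* else 1.
Proof.
rewrite /lam' mxE; case: splitP => i' /= Hi; rewrite mxE;
  case: splitP => j' /= Hj;
  rewrite Hi Hj mxE ?ltn_ord //.
Qed.

Fact S7_nontrivial : (1 : presented S7rel) != 0.
Proof.
apply: (@presented_nontrivial C 'I_4 S7rel C^o
  (fun i => if i == 0 then 1 else 0)).
move=> t u [i j|i j|i j|] /=; rewrite -?scalerAl ?mul1r /star /=.
- case: eqP => [->|_]; case: eqP => [->|_];
    rewrite ?(mulr0, mul0r, mulr1, scaler0) // lam'E scale1r //.
- case: eqP => [->|_]; case: eqP => [->|_];
    rewrite ?(rmorph0, rmorph1, mulr0, mul0r, mulr1, scaler0) // lam'E scale1r //.
- case: eqP => [->|_]; case: eqP => [->|_];
    rewrite ?(rmorph0, rmorph1, mulr0, mul0r, mulr1, scaler0) // lam'E scale1r //.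
- by rewrite !mul0r !addr0 rmorph1 scale1r.
Qed.

HB.instance Definition _ := GRing.PzRing.on S7.
HB.instance Definition _ := GRing.Lmodule.on S7.
HB.instance Definition _ := GRing.PzSemiRing_isNonZero.Build S7 S7_nontrivial.
HB.instance Definition _ := GRing.Lmodule_isLalgebra.Build C S7
  (@presented_scalerAl _ _ S7rel).
HB.instance Definition _ := GRing.Lalgebra_isAlgebra.Build C S7
  (@presented_scalerAr _ _ S7rel).
HB.instance Definition _ := isStarAlgebra.Build C S7 (@pstarK _ _ S7rel)
  (@pstarD _ _ S7rel) (@pstarM _ _ S7rel) (@pstarZ _ _ S7rel).

Definition S7z (i : 'I_4) : S7 := pgen i.

Lemma S7_seval t : seval S7z t = pclass S7rel t.
Proof.
elim: t => [g|c|t IHt u IHu|t IHt u IHu|t IHt] //=.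
- by rewrite pclassC.
- by rewrite IHt IHu -pclassD.
- by rewrite IHt IHu -pclassM.
- by rewrite IHt pclassS.
Qed.

Lemma S7_rel t u : S7rel t u -> seval S7z t = seval S7z u.
Proof. by move=> tu; rewrite !S7_seval; apply/pclassP/sc_rel. Qed.

Lemma S7zz i j : S7z i * S7z j = lam' i j *: (S7z j * S7z i).
Proof. by have /= := S7_rel (S7_zz i j); rewrite -scalerAl mul1r. Qed.
Lemma S7zsz i j : star (S7z i) * S7z j = lam' j i *: (S7z j * star (S7z i)).
Proof. by have /= := S7_rel (S7_zsz i j); rewrite -scalerAl mul1r. Qed.
Lemma S7zszs i j :
  star (S7z i) * star (S7z j) = lam' i j *: (star (S7z j) * star (S7z i)).
Proof. by have /= := S7_rel (S7_zszs i j); rewrite -scalerAl mul1r. Qed.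
Lemma S7sphere : \sum_(i < 4) S7z i * star (S7z i) = 1.
Proof.
by have /= := S7_rel S7_sphere; rewrite scale1r sum_ord4.
Qed.

(* An algebra morphism commuting with the stars is determined by its values on *)
(* the generators.                                                             *)
Lemma S7_hom_ext (A : starAlgType C) (f g : {lrmorphism S7 -> A}) :
  {morph f : a / star a} -> {morph g : a / star a} ->
  (forall i, f (S7z i) = g (S7z i)) -> f =1 g.
Proof.
move=> fS gS fg; elim/pclass_ind => t; rewrite -S7_seval.
elim: t => [i|c|t IHt u IHu|t IHt u IHu|t IHt] /=; first exact: fg.
- by rewrite !linearZ /= !rmorph1.
- by rewrite !rmorphD /= IHt IHu.
- by rewrite !rmorphM /= IHt IHu.
- by rewrite fS gS IHt.
Qed.

Definition is_SU2 (w : 'M[C]_2) : bool := (w \is unitarymx) && (\det w == 1).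
Definition SU2 := {w : 'M[C]_2 | is_SU2 w}.

Implicit Types w : SU2.

Definition SU2_diag w : 'M[C]_(2 + 2) := block_mx (val w) 0 0 (val w).

Lemma SU2_diag_off w (k i : 'I_4) : (k < 2)%N != (i < 2)%N -> SU2_diag w k i = 0.
Proof.
rewrite /SU2_diag mxE; case: splitP => i' /= Hi; rewrite mxE;
  case: splitP => j' /= Hj;
  by rewrite Hi Hj ?mxE ?ltn_ord ?[(_ + _ < _)%N]ltnNge ?leq_addr.
Qed.

Lemma SU2_diag_unitary w : SU2_diag w *m map_mx Num.conj (SU2_diag w)^T = 1%:M.
Proof.
have /andP[/unitarymxP ww _] := valP w; rewrite /SU2_diag.
rewrite tr_block_mx map_block_mx mulmx_block !trmx0 !map_mx0.
by rewrite !(mulmx0, mul0mx, addr0, add0r) ww -scalar_mx_block.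
Qed.

(* Right multiplication of the row (z^1, z^2, z^3, z^4) by diag(w, w).          *)
Definition SU2_act_gen w (j : 'I_4) : S7 :=
  \sum_(i < 4) SU2_diag w i j *: S7z i.

Let star_act_gen w j :
  star (SU2_act_gen w j) = \sum_(i < 4) (SU2_diag w i j)^* *: star (S7z i).
Proof. by rewrite star_sum; apply: eq_bigr => i _; rewrite starZ. Qed.

Let comm_aux (a b : 'I_4 -> S7) (A B m : 'I_4 -> 'I_4 -> C) i j :
  (forall k l, a k * b l = m k l *: (b l * a k)) ->
  (forall k l, A k i * B l j * m k l = A k i * B l j * m i j) ->
  (\sum_k A k i *: a k) * (\sum_l B l j *: b l) =
  m i j *: ((\sum_l B l j *: b l) * (\sum_k A k i *: a k)).
Proof.
move=> ab ABm; rewrite !mulr_suml scaler_sumr.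
under eq_bigr do rewrite mulr_sumr.
rewrite exchange_big; apply: eq_bigr => l _ /=.
rewrite mulr_sumr scaler_sumr; apply: eq_bigr => k _.
rewrite -!scalerAl -!scalerAr ab !scalerA; congr (_ *: _).
by rewrite ABm -[in RHS]mulrA [RHS]mulrC [B _ _ * _]mulrC.
Qed.

Let lam'_block (i j k l : 'I_4) :
  (k < 2)%N = (i < 2)%N -> (l < 2)%N = (j < 2)%N -> lam' k l = lam' i j.
Proof. by rewrite !lam'E => -> ->. Qed.

Fact SU2_act_respects w : srespects S7rel (SU2_act_gen w).
Proof.
have off := SU2_diag_off w.
move=> t u [i j|i j|i j|] /=; rewrite -?scalerAl ?mul1r.
- apply: (@comm_aux S7z S7z (SU2_diag w) (SU2_diag w)); first exact: S7zz.
  move=> k l; case: (eqVneq (k < 2)%N (i < 2)%N) => [ki|/off->];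
    last by rewrite !mul0r.
  case: (eqVneq (l < 2)%N (j < 2)%N) => [lj|/off->];
    last by rewrite !(mulr0, mul0r).
  by rewrite (lam'_block ki lj).
- rewrite !star_act_gen; apply: (@comm_aux (star \o S7z) S7z
    (fun k i => (SU2_diag w k i)^*) (SU2_diag w)
    (fun k l => lam' l k)); first by move=> k l; apply: S7zsz.
  move=> k l; case: (eqVneq (k < 2)%N (i < 2)%N) => [ki|/off->];
    last by rewrite rmorph0 !mul0r.
  case: (eqVneq (l < 2)%N (j < 2)%N) => [lj|/off->];
    last by rewrite !(mulr0, mul0r).
  by rewrite (lam'_block lj ki).
- rewrite !star_act_gen; apply: (@comm_aux (star \o S7z) (star \o S7z)
    (fun k i => (SU2_diag w k i)^*)
    (fun k i => (SU2_diag w k i)^*)); first exact: S7zszs.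
  move=> k l; case: (eqVneq (k < 2)%N (i < 2)%N) => [ki|/off->];
    last by rewrite rmorph0 !mul0r.
  case: (eqVneq (l < 2)%N (j < 2)%N) => [lj|/off->];
    last by rewrite rmorph0 !(mulr0, mul0r).
  by rewrite (lam'_block ki lj).
rewrite scale1r.
transitivity (\sum_(i < 4) SU2_act_gen w i * star (SU2_act_gen w i)).
  by rewrite sum_ord4.
rewrite -S7sphere.
transitivity (\sum_(i < 4) \sum_(k < 4) \sum_(l < 4)
  (SU2_diag w k i * (SU2_diag w l i)^*) *: (S7z k * star (S7z l))).
  apply: eq_bigr => i _; rewrite star_act_gen mulr_suml; apply: eq_bigr => k _.
  rewrite mulr_sumr; apply: eq_bigr => l _.
  by rewrite -scalerAl -scalerAr scalerA.
rewrite exchange_big; apply: eq_bigr => k _ /=.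
rewrite exchange_big (bigD1 k) //= [X in _ + X]big1 ?addr0.
  rewrite -scaler_suml -[RHS]scale1r; congr (_ *: _).
  have /matrixP/(_ k k) := SU2_diag_unitary w; rewrite !mxE eqxx mulr1n => <-.
  by apply: eq_bigr => i _; rewrite !mxE.
move=> l lk; rewrite -scaler_suml.
have /matrixP/(_ k l) := SU2_diag_unitary w; rewrite !mxE eq_sym (negPf lk) mulr0n => kl.
rewrite -[RHS](scale0r (S7z k * star (S7z l))); congr (_ *: _); rewrite -[RHS]kl.
by apply: eq_bigr => i _; rewrite !mxE.
Qed.

Definition SU2_act w : S7 -> S7 := plift (SU2_act_gen w).

Let act_respects w := @SU2_act_respects w.

HB.instance Definition _ w := GRing.isNmodMorphism.Build S7 S7 (SU2_act w)
  (conj (plift0 (@act_respects w)) (pliftD (@act_respects w))).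
HB.instance Definition _ w := GRing.isMonoidMorphism.Build S7 S7 (SU2_act w)
  (conj (plift1 (@act_respects w)) (pliftM (@act_respects w))).
HB.instance Definition _ w := GRing.isScalable.Build C S7 S7 *:%R (SU2_act w)
  (pliftZ (@act_respects w)).

Lemma SU2_act_star w a : SU2_act w (star a) = star (SU2_act w a).
Proof. exact: plift_star (@act_respects w) a. Qed.

Lemma SU2_act_z w j : SU2_act w (S7z j) = \sum_(i < 4) SU2_diag w i j *: S7z i.
Proof. exact: plift_gen (@act_respects w) j. Qed.

Fact SU2_adj_subproof w : is_SU2 (map_mx Num.conj (val w)^T).
Proof.
rewrite /is_SU2.
have /andP[wU /eqP wd] := valP w; rewrite det_map_mx det_tr wd rmorph1 eqxx andbT.
apply/unitarymxP/mulmx1C; rewrite -[RHS](unitarymxP wU); congr (_ *m _).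
by apply/matrixP => i j; rewrite !mxE conjCK.
Qed.

Definition SU2_adj w : SU2 := exist is_SU2 _ (SU2_adj_subproof w).

Lemma SU2_act_comp w v u : val w *m val v = val u ->
  forall a, SU2_act w (SU2_act v a) = SU2_act u a.
Proof.
move=> wvu.
apply: (@S7_hom_ext _ (SU2_act w \o SU2_act v) (SU2_act u)).
- by move=> a /=; rewrite !SU2_act_star.
- by move=> a /=; rewrite SU2_act_star.
move=> j /=; rewrite !SU2_act_z linear_sum /=.
under eq_bigr do rewrite linearZ /= SU2_act_z scaler_sumr.
rewrite exchange_big; apply: eq_bigr => k _ /=.
under eq_bigr do rewrite scalerA mulrC.
rewrite -scaler_suml; congr (_ *: _).
have : SU2_diag w *m SU2_diag v = SU2_diag u.
  by rewrite mulmx_block wvu !(mulmx0, mul0mx, addr0, add0r).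
by move=> /matrixP/(_ k j) <-; rewrite mxE.
Qed.

Lemma SU2_act1 w : val w = 1%:M -> SU2_act w =1 id.
Proof.
move=> w1; apply: (@S7_hom_ext _ (SU2_act w) idfun) => //.
  exact: SU2_act_star.
move=> j /=; rewrite SU2_act_z (bigD1 j) //= big1 ?addr0 /SU2_diag w1.
  by rewrite -scalar_mx_block mxE eqxx scale1r.
by move=> i ij; rewrite -scalar_mx_block mxE (negPf ij) scale0r.
Qed.

Lemma SU2_act_bij w : bijective (SU2_act w).
Proof.
have /andP[/unitarymxP wU _] := valP w.
have one : is_SU2 1%:M.
  by rewrite /is_SU2 det1 eqxx andbT; apply/unitarymxP; rewrite trmx1 map_mx1 mulmx1.
pose e : SU2 := exist is_SU2 _ one.
exists (SU2_act (SU2_adj w)) => a.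
  by rewrite (@SU2_act_comp _ _ e) ?SU2_act1 //=; exact: mulmx1C.
by rewrite (@SU2_act_comp _ _ e) ?SU2_act1.
Qed.

Definition SU2_inv : set S7 := [set a | forall w, SU2_act w a = a].

End Spheres.

Arguments S4alpha {R} theta.
Arguments S4beta {R} theta.
Arguments S4coord {R} theta.
Arguments S7z {R} theta i.
Arguments SU2_inv {R} theta _.

(* Main.v *)
Require Import Defs.
From HB Require Import structures.
From mathcomp Require Import all_boot all_order all_algebra.
From mathcomp Require Import all_classical reals topology normedtype trigo.
From mathcomp.real_closed Require Import complex.
From mathcomp Require Import zify ring.

(** Let p = z_0 z_0^* + z_1 z_1^* and q = z_2 z_2^* + z_3 z_3^*.  They are central
    and p + q = 1.  The images of the generators are twice the pairing of the
    two doublets (z_0, z_1) and (z_2, z_3), twice their determinant up to sign,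
    and p - q.  The sphere relation for them is the Lagrange identity
    ([hab_hpq]), the other relations hold by counting phases, and invariance is
    unitarity of w together with det w = 1 ([SU2_act_hopf]).

    Surjectivity.  Let A be the image and f an invariant element.  Over the
    region where p is invertible the bundle is trivial: as for quaternions,
    where |q1|^2 q2 = (q2 q1^* ) q1 and q2 q1^* is invariant, p z_2 and p z_3
    are combinations of z_0, z_1 and their adjoints with coefficients in A.
    Hence p^N f is, for some N, a combination over A of words in z_0, z_1 and
    their adjoints ([pow_span]).  The Lie algebra of SU(2) acts by derivations
    that kill A and f.  Its Casimir operator is triangular for the length of the
    words, with diagonal entries d (d + 2) as for spherical harmonics on the
    three-sphere; so its kernel among such combinations is A
    ([casimir_ker]), and p^N f lies in A.  By symmetry q^M f lies in A, and
    f = (p + q)^(N + M) f lies in A ([inv_in_hopf]).  The derivations are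
    conjugates of the one that multiplies each generator by its weight under
    the diagonal torus; it kills invariants because these have weight zero
    ([wder_inv]).

    Injectivity.  By the sphere relation each element of the 4-sphere is a sum
    of elements alpha^(n) beta^(m) P(x, beta beta^* ), where negative exponents
    stand for powers of adjoints ([S4_gsum]).  Each point c of the 7-sphere gives
    a representation of the noncommutative 7-sphere, in which the coordinates act
    as multiples c_i U and c_i V of two unitaries with U V = mu V U, shifting the
    functions on a lattice.  There the images of the monomials move the origin to
    distinct lattice points, so that an element of the kernel has all P vanishing
    at enough points to be zero ([hopf_inj]). *)

Set Implicit Arguments.
Unset Strict Implicit.
Unset Printing Implicit Defensive.

Import Order.TTheory GRing.Theory Num.Theory.

Local Open Scope classical_set_scope.
Local Open Scope ring_scope.

(** * Modules over algebras given by generators and relations *)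

Section PresentedModule.
Variables (C : numClosedFieldType) (G : Type).
Variable rel : sterm C G -> sterm C G -> Prop.
Variables (V : lmodType C) (op : bool -> G -> V -> V).

(** To act with a formal expression [t] on a plain vector space [V], where no
    adjoints of operators are available, one keeps two families of operators:
    [op false g] for the generator [g] and [op true g] for its adjoint.  Then
    [mact false t] and [mact true t] are the actions of [t] and of its adjoint,
    and taking a star just switches the boolean. *)
Fixpoint mact (b : bool) (t : sterm C G) : V -> V :=
  match t with
  | SGen g => op b g
  | SConst c => fun v => (if b then c^* else c) *: v
  | SAdd t u => fun v => mact b t v + mact b u v
  | SMul t u => fun v =>
      if b then mact b u (mact b t v) else mact b t (mact b u v)
  | SStar t => mact (~~ b) t
  end.

Definition mrespects := forall t u, rel t u -> forall b, mact b t =1 mact b u.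

Hypothesis op_linear : forall b g, linear (op b g).

Lemma mact_linear b t : linear (mact b t).
Proof.
elim: t b => [g|c|t IHt u IHu|t IHt u IHu|t IHt] b k v w //=.
- exact: op_linear.
- by rewrite scalerDr !scalerA mulrC.
- by rewrite IHt IHu scalerDr addrACA.
- by case: b; rewrite ?IHt ?IHu ?IHt.
- exact: IHt.
Qed.

Lemma mactD b t v w : mact b t (v + w) = mact b t v + mact b t w.
Proof. by have := mact_linear b t 1 v w; rewrite !scale1r. Qed.

Lemma mactZ b t c v : mact b t (c *: v) = c *: mact b t v.
Proof.
have mact0 : mact b t 0 = 0.
  by apply: (addrI (mact b t 0)); rewrite -mactD !addr0.
by have := mact_linear b t c v 0; rewrite mact0 !addr0.
Qed.

Hypothesis op_rel : mrespects.

Lemma scongr_mact t u : scongr rel t u -> forall b, mact b t =1 mact b u.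
Proof.
elim=> {t u} //=.
- by move=> t u _ IH b v; rewrite IH.
- by move=> t u w _ IH1 _ IH2 b v; rewrite IH1 IH2.
- by move=> t t' u u' _ IH1 _ IH2 b v; rewrite IH1 IH2.
- by move=> t t' u u' _ IH1 _ IH2 [] v; rewrite IH1 IH2.
- by move=> t u w b v; rewrite addrA.
- by move=> t u b v; rewrite addrC.
- by move=> t [] v; rewrite ?rmorph0 scale0r add0r.
- by move=> t [] v; rewrite ?mactZ ?rmorphN ?rmorph1 ?rmorph0 scaleN1r addNr scale0r.
- by move=> t u w [] v.
- by move=> t [] v; rewrite ?rmorph1 scale1r.
- by move=> t u w [] v; rewrite ?mactD.
- by move=> t u w [] v; rewrite ?mactD.
- by move=> a c [] v; rewrite ?rmorphD scalerDl.
- by move=> a c [] v; rewrite ?rmorphM scalerA // mulrC.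
- by move=> a t [] v; rewrite mactZ.
- by move=> t b v; rewrite negbK.
- by move=> t u [] v.
- by move=> a [] v; rewrite ?conjCK.
Qed.

Definition pact (a : presented rel) : V -> V := mact false (prepr a).

Lemma pactE t v : pact (pclass rel t) v = mact false t v.
Proof. by apply: scongr_mact; apply: pclassK. Qed.

Lemma pactDl a b v : pact (a + b) v = pact a v + pact b v.
Proof. by elim/pclass_ind: a => t; elim/pclass_ind: b => u; rewrite -pclassD !pactE. Qed.

Lemma pactM a b v : pact (a * b) v = pact a (pact b v).
Proof. by elim/pclass_ind: a => t; elim/pclass_ind: b => u; rewrite -pclassM !pactE. Qed.

Lemma pact1 v : pact 1 v = v.
Proof. by rewrite -pclass1 pactE /= scale1r. Qed.

Lemma pactZl c a v : pact (c *: a) v = c *: pact a v.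
Proof.
by rewrite -[in LHS](mul1r a) (presented_scalerAl c 1 a) -pclassC pactM pactE.
Qed.

Lemma pactZr a c v : pact a (c *: v) = c *: pact a v.
Proof. exact: mactZ. Qed.

Lemma pact_gen g v : pact (pgen g) v = op false g v.
Proof. exact: pactE. Qed.

Lemma pact_star_gen g v : pact (pstar (pgen g)) v = op true g v.
Proof. by rewrite -pclassS pactE. Qed.

End PresentedModule.

Section Words.
Variables (C : numClosedFieldType) (G : Type) (A : starAlgType C) (f : G -> A).
Variable P : A -> Prop.
Hypothesis P1 : P 1.
Hypothesis PD : forall a b, P a -> P b -> P (a + b).
Hypothesis PZ : forall c a, P a -> P (c *: a).
Hypothesis Pg : forall g a, P a -> P (f g * a).
Hypothesis Ps : forall g a, P a -> P (star (f g) * a).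

(** Moving stars inwards turns any expression into a combination of words in
    the generators and their adjoints; the induction proves at the same time
    that left multiplication by [t] and by its adjoint preserve [P]. *)
Lemma seval_word_ind t : P (seval f t).
Proof.
suff H a : P a -> P (seval f t * a) /\ P (star (seval f t) * a).
  by have [] := H 1 P1; rewrite mulr1.
elim: t a => [g|c|t IHt u IHu|t IHt u IHu|t IHt] a Pa /=.
- by split; [apply: Pg|apply: Ps].
- by rewrite starZ star1 -!scalerAl mul1r; split; apply: PZ.
- rewrite starD !mulrDl.
  by have [? ?] := IHt _ Pa; have [? ?] := IHu _ Pa; split; apply: PD.
- rewrite starM -!mulrA.
  by split; [apply: (IHt _ _).1; apply: (IHu _ _).1|
             apply: (IHu _ _).2; apply: (IHt _ _).2].
- by rewrite starK; have [? ?] := IHt _ Pa.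
Qed.

End Words.

Section SphereWords.
Variables (R : realType) (theta : R).
Local Notation C := R[i].
Local Notation S4 := (S4 theta).
Local Notation S7 := (S7 theta).
Local Notation z := (S7z theta).

Lemma S7_word_ind (P : S7 -> Prop) :
  P 1 -> (forall a b, P a -> P b -> P (a + b)) ->
  (forall (c : C) a, P a -> P (c *: a)) ->
  (forall i a, P a -> P (z i * a)) ->
  (forall i a, P a -> P (star (z i) * a)) -> forall a, P a.
Proof.
by move=> P1 PD PZ Pg Ps; elim/pclass_ind => t; rewrite -S7_seval; apply: seval_word_ind.
Qed.

Lemma S4_word_ind (P : S4 -> Prop) :
  P 1 -> (forall a b, P a -> P b -> P (a + b)) ->
  (forall (c : C) a, P a -> P (c *: a)) ->
  (forall g a, P a -> P ((pgen g : S4) * a)) ->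
  (forall g a, P a -> P (star (pgen g : S4) * a)) -> forall a, P a.
Proof.
by move=> P1 PD PZ Pg Ps; elim/pclass_ind => t; rewrite -S4_seval; apply: seval_word_ind.
Qed.

End SphereWords.

(** * Sums of homogeneous elements *)

(** [gsum L v] says that [v] is a sum of homogeneous elements whose degrees
    belong to [L].  Components of different degrees are told apart afterwards,
    by a torus action in one case and by a representation in the other. *)
Section GradedSum.
Variables (K : eqType) (V : zmodType) (hom : K -> V -> Prop).
Hypothesis hom0 : forall k, hom k 0.
Hypothesis homD : forall k v w, hom k v -> hom k w -> hom k (v + w).

Inductive gsum (L : seq K) : V -> Prop :=
  | gsum0 : gsum L 0
  | gsumS k v f : k \in L -> hom k v -> gsum L f -> gsum L (v + f).

Lemma gsum_hom k L v : k \in L -> hom k v -> gsum L v.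
Proof. by move=> kL kv; rewrite -[v]addr0; apply: gsumS kL kv (gsum0 L). Qed.

Lemma gsumD L f g : gsum L f -> gsum L g -> gsum L (f + g).
Proof.
move=> Lf Lg; elim: Lf => [|k v f' kL kv _ IH]; first by rewrite add0r.
by rewrite -addrA; apply: gsumS kL kv IH.
Qed.

Lemma gsum_sub L L' f : {subset L <= L'} -> gsum L f -> gsum L' f.
Proof.
move=> LL; elim=> [|k v f' kL kv _ IH]; first exact: gsum0.
by apply: gsumS kv IH; apply: LL.
Qed.

Lemma gsumD_exists f g :
  (exists L, gsum L f) -> (exists L, gsum L g) -> exists L, gsum L (f + g).
Proof.
move=> [L Lf] [L' Lg]; exists (L ++ L'); apply: gsumD.
  by apply: gsum_sub Lf => k; rewrite mem_cat => ->.
by apply: gsum_sub Lg => k; rewrite mem_cat orbC => ->.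
Qed.

Lemma gsum_map (h : K -> K) (u : V -> V) L f :
  u 0 = 0 -> {morph u : v w / v + w} -> (forall k v, hom k v -> hom (h k) (u v)) ->
  gsum L f -> gsum (map h L) (u f).
Proof.
move=> u0 uD hu; elim=> [|k v f' kL kv _ IH]; first by rewrite u0; apply: gsum0.
by rewrite uD; apply: gsumS (map_f h kL) (hu _ _ kv) IH.
Qed.

(** Splitting off one degree: all the terms of degree [k] are collected in [v],
    so that, when [k] does not occur in [L], the rest has no term of degree
    [k]. *)
Lemma gsum_cons k L f : gsum (k :: L) f ->
  exists v g, [/\ hom k v, gsum L g & f = v + g].
Proof.
elim=> [|k' v f' kL kv _ [w [g [kw Lg ->]]]].
  by exists 0, 0; split; [apply: hom0|apply: gsum0|rewrite addr0].
move: kL; rewrite inE; case: eqP => [kk _|_ /= kL].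
  by exists (v + w), g; split=> //; [apply: homD => //; rewrite -kk|rewrite addrA].
by exists w, (v + g); split=> //; [apply: gsumS kL kv Lg|rewrite addrCA].
Qed.

End GradedSum.

(** * Phases and twisted commutation *)

Section Phases.
Variables (R : realType) (theta : R).
Local Notation C := R[i].
Local Notation mu := (mu theta).
Local Notation lam := (lam theta).
Local Notation lam' := (lam' theta).

Lemma mu_unit : mu * mu^* = 1.
Proof.
rewrite /Defs.mu /expi; apply/eqP; rewrite eq_complex /= !mulrN opprK -!expr2 cos2Dsin2 eqxx /=.
by rewrite mulrC addNr.
Qed.

Lemma mu_unit' : mu^* * mu = 1.
Proof. by rewrite mulrC mu_unit. Qed.

Lemma mu_neq0 : mu != 0.
Proof. by apply/eqP => mu0; move: mu_unit; rewrite mu0 mul0r => /eqP; rewrite eq_sym oner_eq0. Qed.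

Lemma lam_mu : lam = mu * mu.
Proof.
rewrite /Defs.lam /Defs.mu /expi.
have -> : 2 * pi * theta = pi * theta + pi * theta by rewrite -mulrA mulr_natl mulr2n.
by rewrite cosD sinD [in X in (_ +i* X)%C]addrC.
Qed.

Lemma lam'_inv (i j : 'I_4) : lam' i j * lam' j i = 1.
Proof. by rewrite !lam'E; case: (i < 2)%N; case: (j < 2)%N; rewrite ?mulr1 ?mu_unit ?mu_unit'. Qed.

Lemma lam'_block (i j : 'I_4) : (i < 2)%N = (j < 2)%N -> lam' i j = 1.
Proof. by rewrite lam'E => ->; case: (j < 2)%N. Qed.

Lemma lam'_conj (i j : 'I_4) : (lam' i j)^* = lam' j i.
Proof. by rewrite !lam'E; case: (i < 2)%N; case: (j < 2)%N; rewrite ?rmorph1 ?conjCK. Qed.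

End Phases.

Section QCommute.
Variables (C : numClosedFieldType) (A : starAlgType C).
Implicit Types (a b : A) (c d : C).

Definition qcomm c a b := a * b = c *: (b * a).

Lemma qcommDr c a b b' : qcomm c a b -> qcomm c a b' -> qcomm c a (b + b').
Proof. by rewrite /qcomm mulrDr mulrDl scalerDr => -> ->. Qed.

Lemma qcommDl c a a' b : qcomm c a b -> qcomm c a' b -> qcomm c (a + a') b.
Proof. by rewrite /qcomm mulrDr mulrDl scalerDr => -> ->. Qed.

Lemma qcommZr c d a b : qcomm c a b -> qcomm c a (d *: b).
Proof. by rewrite /qcomm -scalerAr -scalerAl => ->; rewrite !scalerA mulrC. Qed.

Lemma qcommZl c d a b : qcomm c a b -> qcomm c (d *: a) b.
Proof. by rewrite /qcomm -scalerAr -scalerAl => ->; rewrite !scalerA mulrC. Qed.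

Lemma qcommNr c a b : qcomm c a b -> qcomm c a (- b).
Proof. by rewrite -scaleN1r; apply: qcommZr. Qed.

Lemma qcommNl c a b : qcomm c a b -> qcomm c (- a) b.
Proof. by rewrite -scaleN1r; apply: qcommZl. Qed.

Lemma qcommMr c d a b b' : qcomm c a b -> qcomm d a b' -> qcomm (c * d) a (b * b').
Proof.
rewrite /qcomm => ab ab'; rewrite mulrA ab -[LHS]scalerAl -[in LHS]mulrA ab'.
by rewrite -scalerAr scalerA mulrA.
Qed.

Lemma qcommMl c d a a' b : qcomm c a b -> qcomm d a' b -> qcomm (c * d) (a * a') b.
Proof.
rewrite /qcomm => ab ab'; rewrite -[LHS]mulrA ab' -[LHS]scalerAr (mulrA a b a') ab.
by rewrite -scalerAl scalerA -mulrA [d * c]mulrC.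
Qed.

Lemma qcomm_star c a b : qcomm c a b -> qcomm c^* (star b) (star a).
Proof. by move=> /(congr1 star); rewrite starZ !starM. Qed.

Lemma qcomm_sym c d a b : d * c = 1 -> qcomm c a b -> qcomm d b a.
Proof. by rewrite /qcomm => dc ->; rewrite scalerA dc scale1r. Qed.

Lemma qcomm1 a b : qcomm 1 a b <-> a * b = b * a.
Proof. by rewrite /qcomm scale1r. Qed.

Lemma starN a : star (- a) = - star a.
Proof. by rewrite -scaleN1r starZ rmorphN rmorph1 scaleN1r. Qed.

End QCommute.

(** * The noncommutative Hopf map *)
Section Hopf.
Variables (R : realType) (theta : R).
Local Notation C := R[i].
Local Notation S4 := (S4 theta).
Local Notation S7 := (S7 theta).
Local Notation z := (S7z theta).
Local Notation s i := (star (S7z theta i)).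
Local Notation mu := (mu theta).
Local Notation lam' := (lam' theta).

Lemma z_z i j : qcomm (lam' i j) (z i) (z j). Proof. exact: S7zz. Qed.
Lemma s_z i j : qcomm (lam' j i) (s i) (z j). Proof. exact: S7zsz. Qed.
Lemma s_s i j : qcomm (lam' i j) (s i) (s j). Proof. exact: S7zszs. Qed.
Lemma z_s i j : qcomm (lam' j i) (z i) (s j).
Proof. by apply: qcomm_sym (s_z j i); rewrite lam'_inv. Qed.

Definition modsq i : S7 := z i * s i.

(** The phases produced by z_i and by its adjoint cancel. *)
Lemma modsq_central i a : modsq i * a = a * modsq i.
Proof.
elim/S7_word_ind: a => [|a b Pa Pb|c a Pa|j a Pa|j a Pa].
- by rewrite mulr1 mul1r.
- by rewrite mulrDl mulrDr Pa Pb.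
- by rewrite -scalerAl -scalerAr Pa.
- rewrite mulrA -[RHS]mulrA -Pa [RHS]mulrA; congr (_ * _).
  by apply/qcomm1; rewrite -(lam'_inv theta i j); apply: qcommMl (z_z _ _) (s_z _ _).
- rewrite mulrA -[RHS]mulrA -Pa [RHS]mulrA; congr (_ * _).
  by apply/qcomm1; rewrite -(lam'_inv theta j i); apply: qcommMl (z_s _ _) (s_s _ _).
Qed.

(** The squared norms of the doublets (z_0, z_1) and (z_2, z_3). *)
Definition hp := modsq 0 + modsq 1.
Definition hq := modsq 2 + modsq 3.

Lemma hp_central a : hp * a = a * hp.
Proof. by rewrite mulrDl mulrDr !modsq_central. Qed.

Lemma hq_central a : hq * a = a * hq.
Proof. by rewrite mulrDl mulrDr !modsq_central. Qed.

Lemma hpq1 : hp + hq = 1.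
Proof. by rewrite /hp /hq /modsq -(S7sphere theta) sum_ord4 !addrA. Qed.

(** The invariant pairing of the two doublets, and minus their determinant;
    twice these are the images of alpha and beta. *)
Definition ha : S7 := z 0 * s 2 + z 1 * s 3.
Definition hb : S7 := - (z 0 * z 3) + z 1 * z 2.

Lemma star_modsq i : star (modsq i) = modsq i.
Proof. by rewrite /modsq starM starK. Qed.

Lemma star_hp : star hp = hp. Proof. by rewrite starD !star_modsq. Qed.
Lemma star_hq : star hq = hq. Proof. by rewrite starD !star_modsq. Qed.

Lemma star_ha : star ha = z 2 * s 0 + z 3 * s 1.
Proof. by rewrite starD !starM !starK. Qed.

Lemma star_hb : star hb = - (s 3 * s 0) + s 2 * s 1.
Proof. by rewrite starD starN !starM. Qed.

(** Both summands of [ha], and both summands of [hb], have the same bidegree in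
    the two doublets, and the phases only depend on it; hence [ha] and [hb]
    commute with each generator up to one phase. *)
Lemma z_ha k : qcomm (lam' k 0 * lam' 2 k) (z k) ha.
Proof.
apply: qcommDr; first exact: qcommMr (z_z _ _) (z_s _ _).
have -> : lam' k 0 * lam' 2 k = lam' k 1 * lam' 3 k by rewrite !lam'E.
exact: qcommMr (z_z _ _) (z_s _ _).
Qed.

Lemma s_ha k : qcomm (lam' 0 k * lam' k 2) (s k) ha.
Proof.
apply: qcommDr; first exact: qcommMr (s_z _ _) (s_s _ _).
have -> : lam' 0 k * lam' k 2 = lam' 1 k * lam' k 3 by rewrite !lam'E.
exact: qcommMr (s_z _ _) (s_s _ _).
Qed.

Lemma z_hb k : qcomm (lam' k 0 * lam' k 3) (z k) hb.
Proof.
apply: qcommDr; first exact: qcommNr (qcommMr (z_z _ _) (z_z _ _)).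
have -> : lam' k 0 * lam' k 3 = lam' k 1 * lam' k 2 by rewrite !lam'E.
exact: qcommMr (z_z _ _) (z_z _ _).
Qed.

Lemma s_hb k : qcomm (lam' 0 k * lam' 3 k) (s k) hb.
Proof.
apply: qcommDr; first exact: qcommNr (qcommMr (s_z _ _) (s_z _ _)).
have -> : lam' 0 k * lam' 3 k = lam' 1 k * lam' 2 k by rewrite !lam'E.
exact: qcommMr (s_z _ _) (s_z _ _).
Qed.

Lemma ha_hb : qcomm (lam theta) ha hb.
Proof.
have e (k l : 'I_4) : (k < 2)%N -> (l < 2)%N = false ->
    lam theta = (lam' k 0 * lam' k 3) * (lam' 0 l * lam' 3 l).
  by move=> k2 l2; rewrite !lam'E k2 l2 /= mul1r mulr1 lam_mu.
by apply: qcommDl; [rewrite (e 0 2)|rewrite (e 1 3)] => //;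
  apply: qcommMl (z_hb _) (s_hb _).
Qed.

Lemma ha_shb : qcomm (lam theta)^* ha (star hb).
Proof.
have sab : qcomm (lam theta)^* (star ha) hb.
  rewrite star_ha lam_mu rmorphM.
  have e (k l : 'I_4) : (k < 2)%N = false -> (l < 2)%N ->
      mu^* * mu^* = (lam' k 0 * lam' k 3) * (lam' 0 l * lam' 3 l).
    by move=> k2 l2; rewrite !lam'E l2 k2 /= mul1r mulr1.
  by apply: qcommDl; [rewrite (e 2 0)|rewrite (e 3 1)] => //;
    apply: qcommMl (z_hb _) (s_hb _).
have /qcomm_star := sab; rewrite starK conjCK => sba.
by apply: qcomm_sym sba; rewrite lam_mu rmorphM mulrACA mu_unit' mulr1.
Qed.

Lemma ha_normal : ha * star ha = star ha * ha.
Proof.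
rewrite star_ha; apply/esym/qcomm1.
have e (k l : 'I_4) : (k < 2)%N = false -> (l < 2)%N ->
    1 = (lam' k 0 * lam' 2 k) * (lam' 0 l * lam' l 2).
  by move=> k2 l2; rewrite !lam'E l2 k2 /= mul1r mulr1 mu_unit'.
by apply: qcommDl; [rewrite (e 2 0)|rewrite (e 3 1)] => //;
  apply: qcommMl (z_ha _) (s_ha _).
Qed.

Lemma hb_normal : hb * star hb = star hb * hb.
Proof.
rewrite star_hb; apply/esym/qcomm1.
have e (k l : 'I_4) : (k < 2)%N = false -> (l < 2)%N ->
    1 = (lam' 0 k * lam' 3 k) * (lam' 0 l * lam' 3 l).
  by move=> k2 l2; rewrite !lam'E l2 k2 /= mul1r mulr1 mu_unit.
apply: qcommDl; [rewrite (e 3 0)|rewrite (e 2 1)] => //; last first.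
  exact: qcommMl (s_hb _) (s_hb _).
by apply: qcommNl; apply: qcommMl (s_hb _) (s_hb _).
Qed.

Lemma z_s_block (i j : 'I_4) : (i < 2)%N = (j < 2)%N -> z i * s j = s j * z i.
Proof. by move=> ij; apply/qcomm1; have := z_s i j; rewrite lam'_block. Qed.

Lemma modsqM i j : modsq i * modsq j = z i * (z j * s j) * s i.
Proof. by rewrite -/(modsq j) -[in RHS]mulrA [modsq j * s i]modsq_central mulrA. Qed.

(** The Lagrange identity for two vectors of a plane.  The cross terms of
    [ha * star ha] and [hb * star hb] are opposite because z_2 and z_3^*, and
    z_3 and z_2^*, commute exactly. *)
Lemma hab_hpq : ha * star ha + hb * star hb = hp * hq.
Proof.
have zs (i j k l : 'I_4) : (k < 2)%N = (j < 2)%N ->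
    z i * s j * (z k * s l) = z i * (z k * s j) * s l.
  by move=> kj; rewrite (z_s_block kj) !mulrA.
rewrite star_ha star_hb /ha /hb /hp /hq !mulrDl !mulrDr !(mulNr, mulrN) opprK.
rewrite !modsqM !zs // !(mulrA (z _) (z _) (s _)) -!(mulrA (z _ * z _) (s _) (s _)).
rewrite [z 0 * z 3 * (s 2 * s 1)]lock [z 1 * z 2 * (s 3 * s 0)]lock.
rewrite (AC ((2*2)*(2*2)) (((2*6)*(3*7))*((1*5)*(8*4)))) /=.
by rewrite !subrr addr0 add0r.
Qed.

Lemma hx_sq : (hp - hq) * (hp - hq) + 4%:R *: (hp * hq) = 1.
Proof.
move: hpq1 (hp_central hq); move: hp hq => p q pq1 pq.
rewrite -[RHS]mulr1 -[in X in _ = X * _]pq1 -[in RHS]pq1.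
rewrite !mulrDl !mulrDr !(mulrN, mulNr) opprK pq.
rewrite scaler_nat -[4%N]/(2 + 2)%N mulrnDr mulr2n.
rewrite (AC ((2*2)*(2*2)) (((1*5)*(6*4))*((2*7)*(3*8)))) /=.
by rewrite !addNr !addr0.
Qed.

Definition hopf_gen (g : S4gen) : S7 :=
  match g with S4a => 2 *: ha | S4b => 2 *: hb | S4x => hp - hq end.

Fact hopf_respects : srespects (@S4rel R theta) hopf_gen.
Proof.
have s2 a : star ((2 : C) *: a : S7) = 2 *: star a by rewrite starZ rmorph_nat.
move=> t u [v||||||] /=; rewrite -?[(_ *: 1) * _]scalerAl ?mul1r ?s2.
- by rewrite mulrBl mulrBr hp_central hq_central.
- by rewrite starD starN star_hp star_hq.
- exact/qcommZl/qcommZr/ha_hb.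
- exact/qcommZl/qcommZr/ha_shb.
- by apply/qcomm1/qcommZl/qcommZr/qcomm1/ha_normal.
- by apply/qcomm1/qcommZl/qcommZr/qcomm1/hb_normal.
rewrite -!scalerAl -!scalerAr !scalerA -scalerDr hab_hpq addrC scale1r -natrM.
exact: hx_sq.
Qed.

Definition hopf : S4 -> S7 := plift hopf_gen.

HB.instance Definition _ := GRing.isNmodMorphism.Build S4 S7 hopf
  (conj (plift0 hopf_respects) (pliftD hopf_respects)).
HB.instance Definition _ := GRing.isMonoidMorphism.Build S4 S7 hopf
  (conj (plift1 hopf_respects) (pliftM hopf_respects)).
HB.instance Definition _ := GRing.isScalable.Build C S4 S7 *:%R hopf
  (pliftZ hopf_respects).

Lemma hopf_star a : hopf (star a) = star (hopf a).
Proof. exact: plift_star hopf_respects a. Qed.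

Lemma hopf_genE g : hopf (pgen g : S4) = hopf_gen g.
Proof. exact: plift_gen hopf_respects g. Qed.

End Hopf.

(** * A Casimir operator separating the invariants *)

Section Casimir.
Variables (C : numClosedFieldType) (S : algType C) (inA : S -> Prop).
Hypothesis A1 : inA 1.
Hypothesis AD : forall a b, inA a -> inA b -> inA (a + b).
Hypothesis AM : forall a b, inA a -> inA b -> inA (a * b).
Hypothesis AZ : forall (c : C) a, inA a -> inA (c *: a).

Variables (I : finType) (g : I -> S) (p : S).
Hypothesis Ap : inA p.
Hypothesis gC : forall i j, g i * g j = g j * g i.
Hypothesis gA : forall i a, inA a -> exists2 a', inA a' & g i * a = a' * g i.

(** The situation: [A] is a subalgebra killed by derivations [D k], and the [g i]
    are finitely many commuting elements normalizing [A].  The elements of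
    [Aspan d] are combinations, with coefficients in [A], of words of length
    less than [d] in the [g i].  The aim is [casimir_ker]: an element of
    [Aspan d] killed by the Casimir operator, the sum of the squares of the
    [D k], lies in [A]. *)
Inductive gword : nat -> S -> Prop :=
  | gword0 : gword 0 1
  | gwordS d i m : gword d m -> gword d.+1 (g i * m).

Inductive Aspan (d : nat) : S -> Prop :=
  | Aspan0 : Aspan d 0
  | AspanS a e m x : inA a -> (e < d)%N -> gword e m -> Aspan d x ->
      Aspan d (a * m + x).

Lemma Aspan_add d x y : Aspan d x -> Aspan d y -> Aspan d (x + y).
Proof.
move=> Ax Ay; elim: Ax => [|a e m x' Aa ed em _ IH]; first by rewrite add0r.
by rewrite -addrA; apply: (AspanS Aa ed em IH).
Qed.

Lemma Aspan_term d e a m : inA a -> (e < d)%N -> gword e m -> Aspan d (a * m).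
Proof. by move=> Aa ed em; rewrite -[_ * _]addr0; apply: (AspanS Aa ed em (Aspan0 d)). Qed.

Lemma Aspan_le d d' x : (d <= d')%N -> Aspan d x -> Aspan d' x.
Proof.
move=> dd; elim=> [|a e m y Aa ed em _ IH]; first exact: Aspan0.
by apply: (AspanS Aa _ em IH); apply: leq_trans dd.
Qed.

Lemma Aspan_mulA d a x : inA a -> Aspan d x -> Aspan d (a * x).
Proof.
move=> Aa; elim=> [|b e m y Ab ed em _ IH]; first by rewrite mulr0; apply: Aspan0.
by rewrite mulrDr mulrA; apply: (AspanS (AM Aa Ab) ed em IH).
Qed.

Lemma Aspan_scale d (c : C) x : Aspan d x -> Aspan d (c *: x).
Proof. by rewrite -[x in c *: x]mul1r scalerAl; apply: Aspan_mulA; apply: AZ. Qed.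

Lemma Aspan_mulg d i x : Aspan d x -> Aspan d.+1 (g i * x).
Proof.
elim=> [|a e m y Aa ed em _ IH]; first by rewrite mulr0; apply: Aspan0.
have [a' Aa' ga] := gA i Aa.
by rewrite mulrDr mulrA ga -mulrA; apply: (AspanS Aa' _ (gwordS i em) IH).
Qed.

Lemma Aspan1 x : Aspan 1 x -> inA x.
Proof.
elim=> [|a [|//] m y Aa _ em _ Ay]; first by rewrite -(scale0r (1 : S)); apply: AZ.
by apply: AD Ay; inversion em; rewrite mulr1.
Qed.

Variables (K : finType) (D : K -> S -> S).
Hypothesis DD : forall k a b, D k (a + b) = D k a + D k b.
Hypothesis DM : forall k a b, D k (a * b) = D k a * b + a * D k b.
Hypothesis DA : forall k a, inA a -> D k a = 0.

(** [Dcross] is the polarization of the second order operator [casimir]. *)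
Definition Dcross x y := \sum_k D k x * D k y.
Definition casimir x := \sum_k D k (D k x).

Hypothesis Dg_comm : forall k i j, D k (g i) * g j = g j * D k (g i).
Hypothesis Dcross_g : forall i j, exists c : C, Dcross (g i) (g j) = g i * g j + c *: p.
Hypothesis casimir_g : forall i, casimir (g i) = 3%:R *: g i.

Lemma D0 k : D k 0 = 0.
Proof. by apply: (addrI (D k 0)); rewrite -DD !addr0. Qed.

Lemma casimirD x y : casimir (x + y) = casimir x + casimir y.
Proof. by rewrite -big_split; apply: eq_bigr => k _; rewrite !DD. Qed.

Lemma casimirM x y : casimir (x * y) = casimir x * y + x * casimir y + 2%:R *: Dcross x y.
Proof.
rewrite /casimir mulr_suml mulr_sumr scaler_sumr -!big_split; apply: eq_bigr => k _ /=.
by rewrite DM DD !DM scaler_nat mulr2n (AC (2*2) ((1*4)*(2*3))) /=.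
Qed.

Lemma casimirA a x : inA a -> casimir (a * x) = a * casimir x.
Proof.
move=> Aa; rewrite /casimir mulr_sumr; apply: eq_bigr => k _.
by rewrite DM (DA k Aa) mul0r add0r DM (DA k Aa) mul0r add0r.
Qed.

(** On generators [Dcross (g i)] multiplies by [g i], up to a multiple of [p];
    being a derivation in its second argument, it multiplies words of length [d]
    by [d * g i].  As [p] lies in [A], the error has coefficients in [A] and
    shorter words. *)
Lemma Dcross_word i d m : gword d m ->
  exists2 r, Aspan d r & Dcross (g i) m = d%:R *: (g i * m) + r.
Proof.
elim=> {d m} [|d j m dm [r dr IH]].
  exists 0; first exact: Aspan0.
  by rewrite scale0r addr0 /Dcross big1 // => k _; rewrite (DA k A1) mulr0.
have [c ijc] := Dcross_g i j.
exists ((c *: p) * m + g j * r).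
  by apply: Aspan_add (Aspan_mulg _ dr); apply: (Aspan_term (AZ _ Ap) _ dm).
have -> : Dcross (g i) (g j * m) = Dcross (g i) (g j) * m + g j * Dcross (g i) m.
  rewrite /Dcross mulr_suml mulr_sumr -big_split; apply: eq_bigr => k _ /=.
  by rewrite DM mulrDr !mulrA Dg_comm.
have ji : g i * (g j * m) = g j * (g i * m) by rewrite !mulrA gC.
rewrite ijc IH mulrDl mulrDr -scalerAr -[g i * g j * m]mulrA ji.
by rewrite (AC (2*2) ((1*3)*(2*4))) /= -nat1r scalerDl scale1r.
Qed.

(** Modulo shorter words, a word of length [d] is an eigenvector of the Casimir
    operator with eigenvalue d (d + 2), as spherical harmonics of degree d on
    the three-sphere are for the Laplacian.  The step is
    3 + d (d + 2) + 2 d = (d + 1) (d + 3). *)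
Lemma casimir_word d m : gword d m ->
  exists2 r, Aspan d r & casimir m = (d * d.+2)%:R *: m + r.
Proof.
elim=> {d m} [|d i m dm [r dr IH]].
  exists 0; first exact: Aspan0.
  rewrite scale0r addr0 /casimir big1 // => k _.
  by rewrite (DA k A1) D0.
have [r' dr' cr'] := Dcross_word i dm.
exists (g i * r + 2%:R *: r').
  apply: Aspan_add; first exact: Aspan_mulg.
  exact/Aspan_scale/(Aspan_le (leqnSn d)).
rewrite casimirM casimir_g IH cr' mulrDr scalerDr -scalerAl -scalerAr scalerA.
rewrite (AC ((1*2)*2) ((1*2*4)*(3*5))) /= -!scalerDl; congr (_ *: _ + _).
by rewrite -natrM -!natrD; congr _%:R; rewrite !mulnS !mulSn; lia.
Qed.

Lemma casimir_lower d x : Aspan d.+1 x ->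
  exists2 r, Aspan d r & casimir x = (d * d.+2)%:R *: x + r.
Proof.
elim=> [|a e m y Aa]; first exists 0; first exact: Aspan0.
  rewrite scaler0 addr0 /casimir big1 // => k _.
  by rewrite !D0.
rewrite ltnS => ed em _ [r dr IH]; have [r' er' cm] := casimir_word em.
rewrite casimirD casimirA // IH cm.
exists (a * (((e * e.+2)%:R - (d * d.+2)%:R) *: m + r') + r).
  apply: Aspan_add => //; apply: (Aspan_mulA Aa); apply: Aspan_add; last exact: Aspan_le er'.
  have [->|ne] := eqVneq e d; first by rewrite subrr scale0r; apply: Aspan0.
  apply: Aspan_scale; rewrite -[m]mul1r; apply: (Aspan_term A1 _ em).
  by rewrite ltn_neqAle ne.
rewrite scalerBl !scalerDr !mulrDr mulrN -!scalerAr.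
by rewrite [RHS](AC (2*((2*1)*1)) (((1*4)*3*5)*(2*6))) /= subrr add0r.
Qed.

(** If the Casimir operator kills [x], the nonzero eigenvalue on the longest
    words forces [x] into the span of shorter ones; descend to the empty
    word. *)
Lemma casimir_ker d x : Aspan d x -> casimir x = 0 -> inA x.
Proof.
elim: d => [|[|d] IH] dx cx.
- by apply: Aspan1; apply: Aspan_le dx.
- exact: Aspan1.
apply: IH (cx); have [r dr] := casimir_lower dx; rewrite cx => /eqP.
rewrite eq_sym addr_eq0 => /eqP xr; have n0 : (d.+1 * d.+3)%:R != 0 :> C.
  by rewrite pnatr_eq0.
rewrite -[x]scale1r -(mulVf n0) -scalerA xr -scaleN1r.
by do 2 apply: Aspan_scale.
Qed.

End Casimir.

(** * The action of SU(2) *)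

Lemma sum_ord2 (V : zmodType) (F : 'I_2 -> V) : \sum_i F i = F 0 + F 1.
Proof. by rewrite !big_ord_recr big_ord0 /= add0r; congr (_ + _); congr F; apply: val_inj. Qed.

Lemma det_mx2 (K : comRingType) (A : 'M[K]_2) : \det A = A 0 0 * A 1 1 - A 0 1 * A 1 0.
Proof.
rewrite (expand_det_row _ 0) sum_ord2 /cofactor !det_mx11 !mxE expr0 mul1r.
rewrite expr1 mulN1r mulrN; congr (_ * A _ _ - _ * A _ _); exact: val_inj.
Qed.

Section SU2Action.
Variables (R : realType) (theta : R).
Local Notation C := R[i].
Local Notation S4 := (S4 theta).
Local Notation S7 := (S7 theta).
Local Notation z := (S7z theta).
Local Notation hopf := (@hopf R theta).
Implicit Types w : SU2 R.

(** The four coordinates form two doublets, transformed in the same way;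
    [zb b j] is coordinate [j] of the doublet [b]. *)
Definition blk (b : bool) (j : 'I_2) : 'I_4 := if b then rshift 2 j else lshift 2 j.
Definition zb b j : S7 := z (blk b j).

Lemma blkE : [/\ blk false 0 = 0, blk false 1 = 1, blk true 0 = 2 & blk true 1 = 3].
Proof. by split; apply: val_inj. Qed.

Lemma blk_lt2 b j : (blk b j < 2)%N = ~~ b.
Proof. by case: b => /=; rewrite ?ltn_ord // ltnNge leq_addr. Qed.

Lemma blkP (i : 'I_4) : exists b j, i = blk b j.
Proof.
by case: (@split_ordP 2 2 i) => j ->; [exists false|exists true]; exists j.
Qed.

Lemma SU2_act_zb w b j : SU2_act w (zb b j) = \sum_(i < 2) val w i j *: zb b i.
Proof.
rewrite /zb SU2_act_z (@big_split_ord _ _ _ 2 2) /= /SU2_diag; case: b => /=.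
  rewrite big1 => [|i _]; last by rewrite block_mxEur mxE scale0r.
  by rewrite add0r; apply: eq_bigr => i _; rewrite block_mxEdr.
rewrite addrC big1 => [|i _]; last by rewrite block_mxEdl mxE scale0r.
by rewrite add0r; apply: eq_bigr => i _; rewrite block_mxEul.
Qed.

(** The pairings [hip] are invariant because [w] is unitary, the determinants
    [hdet] because it has determinant one. *)
Definition hip b b' := \sum_(j < 2) zb b j * star (zb b' j).

Lemma SU2_act_hip w b b' : SU2_act w (hip b b') = hip b b'.
Proof.
have /andP[/unitarymxP ww _] := valP w.
rewrite /hip rmorph_sum /=.
transitivity (\sum_(j < 2) \sum_(i < 2) \sum_(k < 2)
    (val w i j * (val w k j)^*) *: (zb b i * star (zb b' k))).
  apply: eq_bigr => j _; rewrite rmorphM /= SU2_act_star !SU2_act_zb star_sum mulr_suml.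
  apply: eq_bigr => i _; rewrite mulr_sumr; apply: eq_bigr => k _.
  by rewrite starZ -scalerAl -scalerAr scalerA.
rewrite exchange_big; apply: eq_bigr => i _ /=; rewrite exchange_big /=.
have wik k : \sum_(j < 2) val w i j * (val w k j)^* = (i == k)%:R.
  by have /matrixP/(_ i k) := ww; rewrite !mxE => <-; apply: eq_bigr => j _; rewrite !mxE.
under eq_bigr => k _ do rewrite -scaler_suml wik.
rewrite (bigD1 i) //= eqxx scale1r big1 ?addr0 // => k ki.
by rewrite eq_sym (negPf ki) scale0r.
Qed.

Lemma hpE : hp theta = hip false false.
Proof. by case: blkE => e0 e1 _ _; rewrite /hip sum_ord2 /zb ?e0 ?e1 ?e2 ?e3. Qed.
Lemma hqE : hq theta = hip true true.
Proof. by case: blkE => _ _ e2 e3; rewrite /hip sum_ord2 /zb ?e0 ?e1 ?e2 ?e3. Qed.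
Lemma haE : ha theta = hip false true.
Proof.
by case: blkE => e0 e1 e2 e3; rewrite /hip sum_ord2 /zb e0 e1 e2 e3.
Qed.

Definition hdet b b' := zb b 0 * zb b' 1 - zb b 1 * zb b' 0.

Lemma hbE : hb theta = - hdet false true.
Proof. by case: blkE => e0 e1 e2 e3; rewrite /hdet /zb e0 e1 e2 e3 opprB addrC. Qed.

Lemma SU2_act_hdet w b b' : SU2_act w (hdet b b') = hdet b b'.
Proof.
have /andP[_ /eqP] := valP w; rewrite det_mx2 => dw.
rewrite /hdet rmorphB !rmorphM /= !SU2_act_zb !sum_ord2.
rewrite !mulrDl !mulrDr -!scalerAl -!scalerAr !scalerA.
rewrite !opprD -!(scaleNr _ (zb _ _ * _)) (AC ((2*2)*(2*2)) (((1*5)*(2*6))*((3*7)*(4*8)))) /= -!scalerDl.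
move: dw; set A := val w 0 0; set B := val w 0 1; set E := val w 1 0; set F := val w 1 1 => dw.
have -> : A * B - B * A = 0 by ring.
have -> : A * F - B * E = 1 by [].
have -> : E * B - F * A = - (A * F - B * E) by ring.
have -> : E * F - F * E = 0 by ring.
by rewrite dw !scale0r addr0 add0r scale1r scaleN1r.
Qed.

Lemma SU2_act_hopf w a : SU2_act w (hopf a) = hopf a.
Proof.
apply: (@S4_hom_ext _ _ _ (SU2_act w \o hopf) hopf).
- by move=> x /=; rewrite hopf_star SU2_act_star.
- exact: hopf_star.
- by rewrite /= hopf_genE /= linearZ /= haE SU2_act_hip.
- by rewrite /= hopf_genE /= linearZ /= hbE linearN /= SU2_act_hdet.
- by rewrite /= hopf_genE /= linearB /= hpE hqE !SU2_act_hip.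
Qed.

End SU2Action.

(** * The infinitesimal generator of the diagonal torus *)
Section S7Modules.
Variables (R : realType) (theta : R).
Local Notation C := R[i].
Local Notation S7 := (S7 theta).
Local Notation lam' := (lam' theta).
Variables (V : lmodType C) (op : bool -> 'I_4 -> V -> V).
Hypothesis op_linear : forall b i, linear (op b i).
Hypothesis op_zz : forall i j v,
  op false i (op false j v) = lam' i j *: op false j (op false i v).
Hypothesis op_sz : forall i j v,
  op true i (op false j v) = lam' j i *: op false j (op true i v).
Hypothesis op_ss : forall i j v,
  op true i (op true j v) = lam' i j *: op true j (op true i v).
Hypothesis op_sphere : forall v, \sum_i op false i (op true i v) = v.

Lemma S7_mrespects : mrespects (@S7rel R theta) op.
Proof.
have opZ b i c v : op b i (c *: v) = c *: op b i v.
  exact: (mactZ (fun b g => op_linear b g) b (SGen i)).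
move=> t u [i j|i j|i j|] [] v /=; rewrite ?opZ ?lam'_conj //.
all: by rewrite ?rmorph1 scale1r -[RHS]op_sphere sum_ord4.
Qed.

End S7Modules.

Section WeightDerivation.
Variables (R : realType) (theta : R).
Local Notation C := R[i].
Local Notation S7 := (S7 theta).
Local Notation z := (S7z theta).

(** [zs true i] is the adjoint of [zs false i]; the diagonal torus of SU(2) acts
    on [zs b i] with weight [wt b i]. *)
Definition zs (b : bool) (i : 'I_4) : S7 := if b then star (z i) else z i.
Definition wt (b : bool) (i : 'I_4) : int := (-1) ^+ (b + i).

(** The derivation multiplying each [zs b i] by its weight is constructed from a
    module structure on pairs: [a] acts by the matrix with rows (a, 0) and
    (Da, a), that is, as a + Da e over the dual numbers (e e = 0).  On generators
    this matrix is prescribed, and the relations hold because they are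
    homogeneous for the weight. *)
Definition wt_op b i (v : S7 * S7) : S7 * S7 :=
  (zs b i * v.1, zs b i * v.2 + (wt b i)%:~R *: (zs b i * v.1)).

Lemma wt_op_linear b i : linear (wt_op b i).
Proof.
move=> c [u v] [u' v']; rewrite /wt_op; congr (_, _) => /=.
  by rewrite mulrDr -scalerAr.
rewrite !mulrDr !scalerDr -!scalerAr !scalerA addrACA; congr (_ + (_ + _)).
by rewrite mulrC.
Qed.

Lemma wt_op_comm (c : C) b i b' j v : qcomm c (zs b i) (zs b' j) ->
  wt_op b i (wt_op b' j v) = c *: wt_op b' j (wt_op b i v).
Proof.
rewrite /qcomm; case: v => u v ab; rewrite /wt_op; congr (_, _) => /=.
  by rewrite mulrA ab -scalerAl mulrA.
rewrite !mulrDr !scalerDr -!scalerAr !mulrA ab -!scalerAl !scalerA -!addrA; congr (_ + _).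
by rewrite addrC; congr (_ *: _ + _ *: _); rewrite mulrC.
Qed.

Lemma wt_op_respects : mrespects (@S7rel R theta) wt_op.
Proof.
apply: S7_mrespects.
- exact: wt_op_linear.
- by move=> i j v; apply: wt_op_comm; apply: z_z.
- by move=> i j v; apply: wt_op_comm; apply: s_z.
- by move=> i j v; apply: wt_op_comm; apply: s_s.
case=> u v; rewrite -[in RHS](mul1r u) -[in RHS](mul1r v) -(S7sphere theta) !mulr_suml.
have -> : forall (F G : 'I_4 -> S7), (\sum_i F i, \sum_i G i) = \sum_i (F i, G i).
  by move=> F G; rewrite !sum_ord4.
apply: eq_bigr => i _; rewrite /wt_op /=; congr (_, _); rewrite ?mulrA //.
rewrite mulrDr -scalerAr !mulrA -addrA -scalerDl /wt /= add0n exprS mulN1r rmorphN addNr.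
by rewrite scale0r addr0.
Qed.

Definition wact := pact wt_op (rel := @S7rel R theta).
Definition wder (a : S7) : S7 := (wact a (1, 0)).2.

Lemma wact_zs b i a v : wact (zs b i * a) v = wt_op b i (wact a v).
Proof.
rewrite /wact (pactM wt_op_linear wt_op_respects).
case: b; first exact: (pact_star_gen wt_op_linear wt_op_respects).
exact: (pact_gen wt_op_linear wt_op_respects).
Qed.

Lemma S7_zs_ind (P : S7 -> Prop) :
  P 1 -> (forall a b, P a -> P b -> P (a + b)) ->
  (forall (c : C) a, P a -> P (c *: a)) ->
  (forall b i a, P a -> P (zs b i * a)) -> forall a, P a.
Proof.
by move=> P1 PD PZ Pg; apply: S7_word_ind => // i; [apply: (Pg false)|apply: (Pg true)].
Qed.

Lemma wact1 v : wact 1 v = v.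
Proof. exact: (pact1 wt_op_linear wt_op_respects). Qed.

Lemma wactD a b v : wact (a + b) v = wact a v + wact b v.
Proof. exact: (pactDl wt_op_linear wt_op_respects). Qed.

Lemma wactZ (c : C) a v : wact (c *: a) v = c *: wact a v.
Proof. exact: (pactZl wt_op_linear wt_op_respects). Qed.

Lemma wactE a u v : wact a (u, v) = (a * u, a * v + wder a * u).
Proof.
elim/S7_zs_ind: a => [|a b Ha Hb|c a Ha|b i a Ha] in u v *.
- by rewrite /wder !wact1 /= !mul1r mul0r addr0.
- by rewrite /wder !wactD Ha Hb /= !mulrDl addrACA.
- rewrite /wder !wactZ !Ha -[LHS]/(c *: (a * u), c *: (a * v + wder a * u)) /=.
  by rewrite mulr1 mulr0 add0r scalerDr !scalerAl.
rewrite /wder !wact_zs !Ha /wt_op /=; congr (_, _); rewrite ?mulrA //.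
by rewrite mulr1 mulr0 add0r mulr1 mulrDr mulrDl -!scalerAl !mulrA addrA.
Qed.

Lemma wderD a b : wder (a + b) = wder a + wder b.
Proof. by rewrite /wder wactD. Qed.

Lemma wderZ (c : C) a : wder (c *: a) = c *: wder a.
Proof. by rewrite /wder wactZ. Qed.

Lemma wder1 : wder 1 = 0.
Proof. by rewrite /wder wact1. Qed.

Lemma wderM a b : wder (a * b) = wder a * b + a * wder b.
Proof.
rewrite {1}/wder /wact (pactM wt_op_linear wt_op_respects) -!/wact wactE wactE /=.
by rewrite !mulr1 mulr0 add0r addrC.
Qed.

Lemma wder_zs b i : wder (zs b i) = (wt b i)%:~R *: zs b i.
Proof. by rewrite -[zs b i]mulr1 /wder wact_zs wact1 /= !mulr1 mulr0 add0r. Qed.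

Lemma zs_star b i : star (zs b i) = zs (~~ b) i.
Proof. by case: b => //=; rewrite starK. Qed.

Lemma wtN b i : wt (~~ b) i = - wt b i.
Proof. by rewrite /wt; case: b => /=; rewrite ?add0n ?add1n exprS mulN1r ?opprK. Qed.

Lemma wder_star a : wder (star a) = - star (wder a).
Proof.
elim/S7_zs_ind: a => [|a b Ha Hb|c a Ha|b i a Ha].
- by rewrite star1 wder1 star0 oppr0.
- by rewrite starD !wderD Ha Hb starD opprD.
- by rewrite starZ !wderZ Ha starZ scalerN.
rewrite starM !wderM Ha starD !starM opprD wder_zs starZ !zs_star wder_zs wtN.
rewrite addrC mulNr; congr (_ + _).
by rewrite rmorph_int mulrNz scaleNr mulrN.
Qed.

End WeightDerivation.

(** * Torus invariants have weight zero *)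

Lemma ord2P (j : 'I_2) : j = 0 \/ j = 1.
Proof. by case: j => [[|[|//]] j2]; [left|right]; apply: val_inj. Qed.

Section SU2Elements.
Variable R : realType.
Local Notation C := R[i].
Variables a b : C.

Definition su2_mx : 'M[C]_2 :=
  \matrix_(i, j) if i == 0 then (if j == 0 then a else b)
                 else (if j == 0 then - b^* else a^*).

Hypothesis ab1 : a * a^* + b * b^* = 1.

Fact su2_mx_SU2 : is_SU2 su2_mx.
Proof.
rewrite /is_SU2 det_mx2 !mxE /=; apply/andP; split; last by rewrite mulrN opprK ab1.
apply/unitarymxP/matrixP => i j; rewrite !mxE sum_ord2 !mxE.
case: (ord2P i) => ->; case: (ord2P j) => -> /=; rewrite ?rmorphN /= ?conjCK.
- by rewrite ab1.
- by rewrite mulrN [b * a]mulrC addNr.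
- by rewrite mulNr [b^* * _]mulrC addNr.
- by rewrite mulrNN addrC -[RHS]ab1 [a^* * _]mulrC [b^* * _]mulrC.
Qed.

Definition su2 : SU2 R := exist (@is_SU2 R) su2_mx su2_mx_SU2.

End SU2Elements.

Section InvariantWeight.
Variables (R : realType) (theta : R).
Local Notation C := R[i].
Local Notation S7 := (S7 theta).
Local Notation zs := (@zs R theta).
Local Notation wder := (@wder R theta).

Lemma SU2_actK w (f : S7) : SU2_act w (SU2_act (SU2_adj w) f) = f.
Proof.
have /andP[/unitarymxP ww _] := valP w.
have e1 : is_SU2 (1%:M : 'M[C]_2).
  by rewrite /is_SU2 det1 eqxx andbT; apply/unitarymxP; rewrite trmx1 map_mx1 mulmx1.
by rewrite (@SU2_act_comp _ _ _ _ (exist (@is_SU2 R) _ e1)) ?SU2_act1.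
Qed.

Fact torus_subproof (u : C) : u * u^* = 1 -> u * u^* + 0 * 0^* = 1.
Proof. by rewrite mul0r addr0. Qed.

Definition torus u (u1 : u * u^* = 1) := su2 (torus_subproof u1).

Lemma torus_act u (u1 : u * u^* = 1) b i :
  SU2_act (torus u1) (zs b i) = (u ^ wt b i) *: zs b i.
Proof.
have u0 : u != 0 by apply: contra_eqN u1 => /eqP->; rewrite mul0r eq_sym oner_eq0.
have uV : u^* = u^-1 by rewrite -[RHS]mulr1 -u1 mulKf.
have act j : SU2_act (torus u1) (zs false j) = (u ^ wt false j) *: zs false j.
  case: (blkP j) => e [k ->]; rewrite -[zs false _]/(zb theta e k) SU2_act_zb sum_ord2 !mxE /wt add0n.
  have -> : (-1 : int) ^+ blk e k = (-1) ^+ k by case: e => //=; rewrite exprD expr2 mulrNN !mul1r.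
  case: (ord2P k) => -> /=.
    by rewrite conjC0 oppr0 scale0r addr0 expr1z.
  by rewrite scale0r add0r uV exprN1.
case: b; last exact: act.
rewrite -[in LHS](zs_star theta false) SU2_act_star act starZ zs_star.
rewrite (wtN false) -invr_expz; congr (_ *: _).
by rewrite rmorphXz ?unitfE //= uV exprz_inv -invr_expz.
Qed.

Lemma wder0 : wder 0 = 0.
Proof. by have := wderZ 0 (0 : S7); rewrite !scale0r. Qed.

(** Weight [k] is expressed twice: the torus condition isolates the components
    of an invariant element, the condition on [wder] gives the value of the
    derivation on them. *)
Definition wvect (k : int) (v : S7) := wder v = k%:~R *: v /\
  forall u (u1 : u * u^* = 1), SU2_act (torus u1) v = (u ^ k) *: v.

Lemma wvect0 k : wvect k 0.
Proof. by split=> [|u u1]; rewrite ?rmorph0 ?wder0 ?scaler0. Qed.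

Lemma wvectD k v w : wvect k v -> wvect k w -> wvect k (v + w).
Proof.
move=> [v1 v2] [w1 w2]; split=> [|u u1]; first by rewrite wderD v1 w1 scalerDr.
by rewrite rmorphD /= v2 w2 scalerDr.
Qed.

Lemma wvectZ k (c : C) v : wvect k v -> wvect k (c *: v).
Proof.
move=> [v1 v2]; split=> [|u u1]; first by rewrite wderZ v1 !scalerA mulrC.
by rewrite linearZ /= v2 !scalerA mulrC.
Qed.

Local Notation wsum := (gsum wvect).

Lemma wsum_exists f : exists L, wsum L f.
Proof.
elim/S7_zs_ind: f => [|a b|c a [L La]|b i a [L La]].
- exists [:: 0]; apply: (gsum_hom (k := 0)) => //.
  by split=> [|u u1]; [rewrite wder1 scale0r|rewrite rmorph1 expr0z scale1r].
- exact: gsumD_exists.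
- exists (map id L); apply: gsum_map La; [exact: scaler0|exact: scalerDr|].
  by move=> k v; apply: wvectZ.
exists [seq wt b i + k | k <- L].
apply: gsum_map La; [exact: mulr0|exact: mulrDr|move=> k v [v1 v2]; split=> [|u u1]].
  by rewrite wderM wder_zs v1 -scalerAl -scalerAr -scalerDl intrD.
rewrite rmorphM /= torus_act v2 -scalerAl -scalerAr scalerA expfzDr //.
by apply: contra_eqN u1 => /eqP->; rewrite mul0r eq_sym oner_eq0.
Qed.

(** Take a |k|-th root of -1. *)
Lemma exists_unit_expz (k : int) : k != 0 -> exists2 u : C, u * u^* = 1 & u ^ k != 1.
Proof.
move=> k0; have n0 : (0 < `|k|)%N by rewrite absz_gt0.
pose u : C := (`|k|%N).-root (-1).
have uk : u ^+ `|k|%N = -1 by rewrite rootCK.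
have m1 : (-1 : C) != 1 by rewrite -subr_eq0 -opprD oppr_eq0 -mulr2n pnatr_eq0.
exists u.
  rewrite -normCK; have /eqP := congr1 Num.norm uk.
  by rewrite normrX normrN1 pexprn_eq1 // eqn0Ngt n0 /= => /eqP ->; rewrite expr1n.
case: (k) uk => m /= um; first by rewrite -exprnP um.
by rewrite NegzE -exprnN um invrN1.
Qed.

(** The weights [k] of an invariant [f] are removed one at a time.  If [k] is not
    zero, choose [u] with [u ^ k != 1]: applying the torus element [u] and
    subtracting [u ^ k *: f] kills the part of weight [k], and only multiplies
    [f] by a nonzero scalar. *)
Lemma wder_inv f : SU2_inv theta f -> wder f = 0.
Proof.
move=> finv; have {finv} : forall u (u1 : u * u^* = 1), SU2_act (torus u1) f = f.
  by move=> u u1; apply: finv.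
have [L] := wsum_exists f; elim: L f => [|k L IH] f Lf finv.
  by inversion Lf; rewrite ?wder0.
have [v [g [kv Lg fvg]]] := gsum_cons wvect0 wvectD Lf.
have [k0|k0] := eqVneq k 0.
  rewrite k0 in kv; rewrite fvg wderD kv.1 scale0r add0r; apply: IH => // u u1.
  have := finv u u1; rewrite fvg rmorphD /= kv.2 expr0z scale1r; exact: addrI.
have [u u1 uk] := exists_unit_expz k0.
have e : (1 - u ^ k) *: f = SU2_act (torus u1) g - u ^ k *: g.
  rewrite scalerBl scale1r -{1}(finv u u1) fvg rmorphD /= kv.2 scalerDr opprD.
  by rewrite addrACA subrr add0r.
have : wder ((1 - u ^ k) *: f) = 0.
  apply: IH => [|u' u1']; last by rewrite linearZ /= finv.
  rewrite e -[L]map_id -scaleNr; apply: gsumD; apply: gsum_map Lg.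
  - exact: rmorph0.
  - exact: rmorphD.
  - by move=> l x lx; rewrite (lx.2); apply: wvectZ.
  - exact: scaler0.
  - exact: scalerDr.
  by move=> l x; apply: wvectZ.
by rewrite wderZ => /eqP; rewrite scaler_eq0 subr_eq0 eq_sym (negPf uk) => /eqP.
Qed.

End InvariantWeight.

(** * Derivations given by the Pauli matrices *)

Section PauliDerivations.
Variables (R : realType) (theta : R).
Local Notation C := R[i].
Local Notation S7 := (S7 theta).
Local Notation zs := (@zs R theta).
Local Notation zb := (@zb R theta).
Local Notation wder := (@wder R theta).
Implicit Types w : SU2 R.

(** Conjugating [wder] by elements of SU(2) gives the other directions of the
    complexified Lie algebra; being conjugates, they kill all invariants as
    soon as [wder] does. *)
Definition pder w (f : S7) : S7 := SU2_act w (wder (SU2_act (SU2_adj w) f)).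

Lemma pderD w f g : pder w (f + g) = pder w f + pder w g.
Proof. by rewrite /pder rmorphD wderD rmorphD. Qed.

Lemma pderZ w (c : C) f : pder w (c *: f) = c *: pder w f.
Proof. by rewrite /pder linearZ /= wderZ linearZ. Qed.

Lemma pderN w f : pder w (- f) = - pder w f.
Proof. by rewrite -scaleN1r pderZ scaleN1r. Qed.

Lemma pderM w f g : pder w (f * g) = pder w f * g + f * pder w g.
Proof. by rewrite /pder rmorphM wderM rmorphD !rmorphM /= !SU2_actK. Qed.

Lemma pder_star w f : pder w (star f) = - star (pder w f).
Proof. by rewrite /pder SU2_act_star wder_star rmorphN /= SU2_act_star. Qed.

Lemma pder_inv w f : SU2_inv theta f -> pder w f = 0.
Proof. by move=> finv; rewrite /pder finv wder_inv // rmorph0. Qed.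

Lemma wder_zb e (j : 'I_2) : wder (zb e j) = (-1) ^+ j *: zb e j.
Proof.
rewrite -[zb e j]/(zs false (blk e j)) wder_zs; congr (_ *: _).
rewrite /wt add0n; have -> : (-1 : int) ^+ blk e j = (-1) ^+ j.
  by case: e => //=; rewrite exprD expr2 mulrNN !mul1r.
by rewrite rmorphXn rmorphN1.
Qed.

Lemma SU2_adjE w i j : val (SU2_adj w) i j = (val w j i)^*.
Proof. by rewrite /= !mxE. Qed.

Lemma su2E (a b : C) (ab1 : a * a^* + b * b^* = 1) :
  [/\ val (su2 ab1) 0 0 = a, val (su2 ab1) 0 1 = b,
      val (su2 ab1) 1 0 = - b^* & val (su2 ab1) 1 1 = a^*].
Proof. by split; rewrite /= mxE. Qed.

(** In matrix form: [pder] at [w] acts on each doublet by w diag(1, -1) w^-1. *)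
Lemma pder_su2 (a b : C) (ab1 : a * a^* + b * b^* = 1) e :
  pder (su2 ab1) (zb e 0) = (a * a^* - b * b^*) *: zb e 0 - (2 * (a^* * b^*)) *: zb e 1 /\
  pder (su2 ab1) (zb e 1) = - (2 * (a * b)) *: zb e 0 - (a * a^* - b * b^*) *: zb e 1.
Proof.
have [e00 e01 e10 e11] := su2E ab1.
rewrite /pder !SU2_act_zb !sum_ord2 !SU2_adjE e00 e01 e10 e11.
have -> : (- b^*)^* = - b by rewrite rmorphN /= conjCK.
rewrite conjCK; move: (a^*) (b^*) e10 e11 => a' b' e10 e11.
rewrite !wderD !wderZ !wder_zb expr0 expr1 -!(scaleNr _ (zb e 1)).
split; rewrite [LHS]rmorphD /= [X in X + _]linearZ [X in _ + X]linearZ /= ![in LHS]linearZ /=.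
  rewrite !SU2_act_zb !sum_ord2 e00 e01 e10 e11 !scalerDr !scalerA.
  by rewrite addrACA -!scalerDl; congr (_ *: _ + _ *: _); ring.
rewrite !SU2_act_zb !sum_ord2 e00 e01 e10 e11 !scalerDr !scalerA.
by rewrite addrACA -!scalerDl; congr (_ *: _ + _ *: _); ring.
Qed.

Let i2 : 'i * 'i = -1 :> C. Proof. by rewrite -expr2 sqrCi. Qed.
Let n2 : 2 * 2^-1 = 1 :> C. Proof. by rewrite mulfV // pnatr_eq0. Qed.
Let h : C := (1 + 'i) / 2.
Let hC : h^* = (1 - 'i) / 2.
Proof. by rewrite /h rmorphM rmorphD /= fmorphV /= rmorph1 rmorph_nat conjCi. Qed.
Let hh : h * h^* = 2^-1.
Proof.
rewrite hC /h; transitivity (2^-1 * (2^-1 * (1 - 'i * 'i)) : C); first by ring.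
by rewrite i2 opprK -mulr2n [2^-1 * 2]mulrC n2 mulr1.
Qed.
Let h2 : h * h = 'i / 2.
Proof.
rewrite /h; transitivity (2^-1 * 2^-1 * (1 + 'i * 'i) + (2 * 2^-1) * ('i / 2) : C).
  by ring.
by rewrite n2 i2 subrr mulr0 add0r mul1r.
Qed.

(** Conjugating diag(1, -1) by these three elements gives the Pauli matrices, up
    to sign; with [h = (1 + 'i) / 2], of square [ 'i / 2], all entries stay free
    of square roots. *)
Fact pauli_subproof (k : 'I_3) :
  let a : C := if k == 0 then 1 else h in
  let b : C := if k == 0 then 0 else if k == 1 then h^* else h in
  a * a^* + b * b^* = 1.
Proof.
case: ifP => _ /=; first by rewrite rmorph1 rmorph0 mulr1 mulr0 addr0.
by case: ifP => _; rewrite ?conjCK 1?[h^* * _]mulrC hh -mulr2n -[RHS]n2 mulr_natl.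
Qed.

Definition pauli k : SU2 R := su2 (pauli_subproof k).

Lemma pauliE e : let x := zb e 0 in let y := zb e 1 in
  [/\ pder (pauli 0) x = x, pder (pauli 0) y = - y,
      pder (pauli 1) x = - y, pder (pauli 1) y = - x &
      pder (pauli 2) x = 'i *: y /\ pder (pauli 2) y = - 'i *: x].
Proof.
have [x0 y0] := pder_su2 (pauli_subproof 0) e.
have [x1 y1] := pder_su2 (pauli_subproof 1) e.
have [x2 y2] := pder_su2 (pauli_subproof 2) e.
have conjh2 : h^* * h^* = - ('i / 2).
  by rewrite -rmorphM h2 rmorphM /= fmorphV rmorph_nat /= conjCi mulNr.
move: x0 y0 x1 y1 x2 y2; rewrite /= !conjCK rmorph1 rmorph0 !(mulr1, mulr0, mul0r).
rewrite !subr0 !hh [h^* * h]mulrC hh h2 conjh2 !subrr.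
rewrite n2 !mulrN [2 * ('i / 2)]mulrCA n2 mulr1.
rewrite !(scale0r, scale1r, scaleN1r, oppr0, scaleNr, add0r, addr0, subr0, opprK).
by move=> -> -> -> -> -> ->.
Qed.

End PauliDerivations.

(** * Surjectivity onto the invariants *)

Lemma sum_ord3 (V : zmodType) (F : 'I_3 -> V) : \sum_i F i = F 0 + F 1 + F 2.
Proof.
rewrite !big_ord_recr big_ord0 /= add0r.
by do !congr (_ + _); congr F; apply: val_inj.
Qed.

(** These identities are the completeness relation of the Pauli matrices.  For
    coordinates u and v of a doublet (x, y) of commuting elements, the sum over
    the three derivations of D u * D v is u v, that of D u * D (v^* ) is u v^*,
    with x x^* + y y^* subtracted twice when u = v. *)
Section PauliIdentities.
Variables (C : numClosedFieldType) (A : starAlgType C) (x y : A).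
Local Notation X := (star x).
Local Notation Y := (star y).
Hypothesis yx : y * x = x * y.
Hypothesis Xx : X * x = x * X.
Hypothesis Yy : Y * y = y * Y.
Hypothesis Yx : Y * x = x * Y.
Hypothesis Xy : X * y = y * X.

Lemma imulN (f g : A) : ('i *: f) * ('i *: g) = - (f * g).
Proof. by rewrite -scalerAl -scalerAr scalerA -expr2 sqrCi scaleN1r. Qed.

Lemma stari (f : A) : star ('i *: f) = - ('i *: star f).
Proof. by rewrite starZ conjCi scaleNr. Qed.

Lemma pauli_xx : x * x + - y * - y + ('i *: y) * ('i *: y) = x * x.
Proof. by rewrite imulN mulrNN addrK. Qed.

Lemma pauli_yy : - y * - y + - x * - x + (- 'i *: x) * (- 'i *: x) = y * y.
Proof. by rewrite scaleNr !mulrNN imulN addrK. Qed.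

Lemma pauli_xy : x * - y + - y * - x + ('i *: y) * (- 'i *: x) = x * y.
Proof. by rewrite scaleNr mulrNN !mulrN imulN opprK yx addNr add0r. Qed.

Lemma pauli_yx : - y * x + - x * - y + (- 'i *: x) * ('i *: y) = y * x.
Proof. by rewrite scaleNr mulrNN !mulNr imulN opprK yx addNr add0r. Qed.

Let dbl (f g : A) : f + (-2 : C) *: (f + g) = - f - g - g.
Proof.
rewrite scaleNr (scaler_nat 2) mulr2n !opprD (AC (1*(2*2)) (((1*2)*4)*3*5)) /= subrr add0r.
by rewrite -!addrA; congr (_ + _).
Qed.

Lemma pauli_xX : x * - star x + - y * - star (- y) + ('i *: y) * - star ('i *: y) =
  x * X + (-2 : C) *: (x * X + y * Y).
Proof. by rewrite dbl starN stari !opprK imulN mulNr mulrN. Qed.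

Lemma pauli_yY : - y * - star (- y) + - x * - star (- x) + (- 'i *: x) * - star (- 'i *: x) =
  y * Y + (-2 : C) *: (x * X + y * Y).
Proof. by rewrite [x * X + _]addrC dbl scaleNr !starN stari !opprK mulrNN imulN !mulNr. Qed.

Lemma pauli_xY : x * - star (- y) + - y * - star (- x) + ('i *: y) * - star (- 'i *: x) = x * Y.
Proof. by rewrite scaleNr !starN stari !opprK mulrN imulN opprK mulNr addrNK. Qed.

Lemma pauli_yX : - y * - star x + - x * - star (- y) + (- 'i *: x) * - star ('i *: y) = y * X.
Proof. by rewrite scaleNr !starN stari !opprK mulrNN !mulNr imulN opprK addrNK. Qed.

End PauliIdentities.

Section Surjectivity.
Variables (R : realType) (theta : R).
Local Notation C := R[i].
Local Notation S4 := (S4 theta).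
Local Notation S7 := (S7 theta).
Local Notation zs := (@zs R theta).
Local Notation zb := (@zb R theta).
Local Notation hopf := (@hopf R theta).
Local Notation hip := (@hip R theta).
Local Notation hdet := (@hdet R theta).

Definition in_hopf (f : S7) := exists y, f = hopf y.

Lemma in_hopf1 : in_hopf 1. Proof. by exists 1; rewrite rmorph1. Qed.
Lemma in_hopfD f g : in_hopf f -> in_hopf g -> in_hopf (f + g).
Proof. by move=> [x ->] [y ->]; exists (x + y); rewrite rmorphD. Qed.
Lemma in_hopfM f g : in_hopf f -> in_hopf g -> in_hopf (f * g).
Proof. by move=> [x ->] [y ->]; exists (x * y); rewrite rmorphM. Qed.
Lemma in_hopfZ (c : C) f : in_hopf f -> in_hopf (c *: f).
Proof. by move=> [x ->]; exists (c *: x); rewrite linearZ. Qed.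
Lemma in_hopf_star f : in_hopf f -> in_hopf (star f).
Proof. by move=> [x ->]; exists (star x); rewrite hopf_star. Qed.
Lemma in_hopf_inv f : in_hopf f -> SU2_inv theta f.
Proof. by move=> [x ->] w; rewrite SU2_act_hopf. Qed.

Lemma half_double (V : lmodType C) (v : V) : 2^-1 *: (v + v) = v.
Proof. by rewrite -mulr2n -(scaler_nat 2 v) scalerA mulVf ?pnatr_eq0 // scale1r. Qed.

Lemma in_hopf_gen g : in_hopf (hopf_gen theta g).
Proof. by exists (pgen g); rewrite hopf_genE. Qed.

Lemma in_hopf_half f : in_hopf ((2 : C) *: f) -> in_hopf f.
Proof. by move=> /(@in_hopfZ 2^-1); rewrite scalerA mulVf ?pnatr_eq0 // scale1r. Qed.

Lemma in_hopf_hip e e' : in_hopf (hip e e').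
Proof.
have ha_in : in_hopf (ha theta) by apply: in_hopf_half; apply: (in_hopf_gen S4a).
case: e e' => [] [].
- rewrite -hqE -[hq _]half_double; apply: in_hopfZ.
  have -> : hq theta + hq theta = 1 + (-1) *: (hp theta - hq theta).
    by rewrite -(hpq1 theta) scaleN1r opprB [RHS](AC (2*2) ((1*4)*(2*3))) /= subrr add0r.
  by apply: in_hopfD in_hopf1 (in_hopfZ _ (in_hopf_gen S4x)).
- suff -> : hip true false = star (hip false true) by rewrite -haE; apply: in_hopf_star.
  by rewrite /hip star_sum; apply: eq_bigr => j _; rewrite starM starK.
- by rewrite -haE.
rewrite -hpE -[hp _]half_double; apply: in_hopfZ.
have -> : hp theta + hp theta = 1 + (hp theta - hq theta).
  by rewrite -(hpq1 theta) [RHS]addrACA subrr addr0.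
exact: in_hopfD in_hopf1 (in_hopf_gen S4x).
Qed.

Lemma zs_comm b b' e i j : zs b (blk e i) * zs b' (blk e j) = zs b' (blk e j) * zs b (blk e i).
Proof.
have eb : (blk e i < 2)%N = (blk e j < 2)%N by rewrite !blk_lt2.
apply/qcomm1; case: b b' => [] [].
- by have := s_s theta (blk e i) (blk e j); rewrite lam'_block.
- by have := s_z theta (blk e i) (blk e j); rewrite lam'_block.
- by have := z_s theta (blk e i) (blk e j); rewrite lam'_block.
- by have := z_z theta (blk e i) (blk e j); rewrite lam'_block.
Qed.

Lemma zb_qcomm e e' i j : zb e i * zb e' j = lam' theta (blk e 0) (blk e' 0) *: (zb e' j * zb e i).
Proof.
rewrite /zb (z_z theta (blk e i) (blk e' j)) !lam'E !blk_lt2.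
by [].
Qed.

Lemma in_hopf_hdet e : in_hopf (hdet (~~ e) e).
Proof.
have hb_in : in_hopf (hdet false true).
  rewrite -[hdet _ _]opprK -hbE -scaleN1r; apply/in_hopfZ/in_hopf_half; exact: (in_hopf_gen S4b).
case: e => //=.
suff -> : hdet true false = - lam' theta (blk true 0) (blk false 0) *: hdet false true.
  by apply: in_hopfZ.
by rewrite /hdet (zb_qcomm true false 0 1) (zb_qcomm true false 1 0) -scalerBr scaleNr -scalerN opprB.
Qed.

Lemma zs_hopf_gen b i g : exists2 c : C, c != 0 & qcomm c (zs b i) (hopf_gen theta g).
Proof.
have l0 k l : lam' theta k l != 0.
  by apply/eqP => l0; have /eqP := lam'_inv theta k l; rewrite l0 mul0r eq_sym oner_eq0.
case: g => /=; last first.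
- by exists 1; [rewrite oner_eq0|apply/qcomm1; rewrite mulrBl mulrBr hp_central hq_central].
- case: b; [exists (lam' theta 0 i * lam' theta 3 i)|exists (lam' theta i 0 * lam' theta i 3)];
    rewrite ?mulf_neq0 //; apply: qcommZr; [exact: s_hb|exact: z_hb].
- case: b; [exists (lam' theta 0 i * lam' theta i 2)|exists (lam' theta i 0 * lam' theta 2 i)];
    rewrite ?mulf_neq0 //; apply: qcommZr; [exact: s_ha|exact: z_ha].
Qed.

(** A generator commutes up to a phase with the images of alpha, beta and x; the
    phase depends on the monomial, so that only the image as a whole is
    preserved. *)
Lemma zs_in_hopf b i a : in_hopf a -> exists2 a', in_hopf a' & zs b i * a = a' * zs b i.
Proof.
have gen (c : C) G x : in_hopf G -> qcomm c (zs b i) G ->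
    (exists2 a', in_hopf a' & zs b i * x = a' * zs b i) ->
    exists2 a', in_hopf a' & zs b i * (G * x) = a' * zs b i.
  move=> AG cG [a' Aa' xa']; exists (c *: G * a'); first by apply: in_hopfM => //; apply: in_hopfZ.
  by rewrite mulrA cG -!scalerAl -!mulrA xa'.
move=> [y ->]; elim/S4_word_ind: y => [|x y [x' Ax Ex] [y' Ay Ey]|c x [x' Ax Ex]|g x IH|g x IH].
- by exists 1; [apply: in_hopf1|rewrite rmorph1 mul1r mulr1].
- by exists (x' + y'); [apply: in_hopfD|rewrite rmorphD mulrDr Ex Ey mulrDl].
- by exists (c *: x'); [apply: in_hopfZ|rewrite linearZ /= -scalerAr Ex scalerAl].
- rewrite rmorphM /= hopf_genE; have [c _ cG] := zs_hopf_gen b i g.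
  exact: gen (in_hopf_gen g) cG IH.
rewrite rmorphM /= hopf_star hopf_genE; have [c c0 cG] := zs_hopf_gen (~~ b) i g.
apply: (gen (c^*)^-1) (in_hopf_star (in_hopf_gen g)) _ IH.
have /qcomm_star := cG; rewrite zs_star negbK => cG'.
by apply: qcomm_sym cG'; rewrite mulVf // conjC_eq0.
Qed.

Lemma in_hopf_hipX e N : in_hopf (hip e e ^+ N).
Proof.
by elim: N => [|N IH]; rewrite ?expr0 ?exprS; [apply: in_hopf1|apply: in_hopfM (in_hopf_hip _ _) IH]. Qed.

Section Block.
Variable e : bool.

Definition bgen (j : bool * 'I_2) : S7 := zs j.1 (blk e j.2).

Lemma hip_central e' f : hip e' e' * f = f * hip e' e'.
Proof. by case: e'; rewrite -?hpE -?hqE ?hp_central ?hq_central. Qed.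

(** For quaternions q1 and q2, |q1|^2 q2 = (q2 q1^* ) q1, and the entries of
    q2 q1^* are invariant.  So a coordinate of the other doublet, once
    multiplied by the squared norm of the doublet [e], is a combination of
    coordinates of the doublet [e] with coefficients in the image. *)
Lemma hip_zs b j : exists a1 a2 j1 j2, [/\ in_hopf a1, in_hopf a2 &
  hip e e * zs b (blk (~~ e) j) = a1 * bgen j1 + a2 * bgen j2].
Proof.
have g0 k : bgen (false, k) = zb e k by [].
have g1 k : bgen (true, k) = star (zb e k) by [].
have cs k l : star (zb e k) * zb e l = zb e l * star (zb e k) := zs_comm true false e k l.
have [a1 [a2 [j1 [j2 [Aa1 Aa2 E]]]]] : exists a1 a2 j1 j2, [/\ in_hopf a1, in_hopf a2 &
    hip e e * zb (~~ e) j = a1 * bgen j1 + a2 * bgen j2].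
  case: (ord2P j) => ->.
    exists (hip (~~ e) e), (hdet (~~ e) e), (false, 0), (true, 1).
    split; [exact: in_hopf_hip|exact: in_hopf_hdet|].
    rewrite hip_central /hip /hdet !sum_ord2 mulrDr !mulrDl mulNr -!mulrA g0 g1 !cs.
    by rewrite [RHS]addrACA subrr addr0.
  exists (hip (~~ e) e), (- hdet (~~ e) e), (false, 1), (true, 0).
  split; [exact: in_hopf_hip| by rewrite -scaleN1r; apply/in_hopfZ/in_hopf_hdet|].
  rewrite hip_central /hip /hdet !sum_ord2 opprB mulrDr !mulrDl mulNr -!mulrA g0 g1 !cs.
  by rewrite [RHS](AC (2*2) ((3*2)*(1*4))) /= subrr addr0.
case: b => /=; last by exists a1, a2, j1, j2.
have bs k : star (bgen k) = bgen (~~ k.1, k.2) by rewrite /bgen zs_star.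
have comm k a : in_hopf a -> exists2 a', in_hopf a' & star (bgen k) * a = a' * star (bgen k).
  by rewrite bs; apply: zs_in_hopf.
have [a1' Aa1' E1] := comm j1 _ (in_hopf_star Aa1).
have [a2' Aa2' E2] := comm j2 _ (in_hopf_star Aa2).
exists a1', a2', (~~ j1.1, j1.2), (~~ j2.1, j2.2); split=> //.
rewrite -!bs -E1 -E2 -!starM -starD -E starM -[star (zb _ _)]/(zs true _) hip_central; congr (_ * _).
by rewrite /hip star_sum; apply: eq_bigr => k _; rewrite starM starK.
Qed.

Lemma bgenC j k : bgen j * bgen k = bgen k * bgen j.
Proof. exact: zs_comm. Qed.

Let Dp k := @pder R theta (pauli R k).
Local Notation cross := (Dcross Dp).
Local Notation cas := (casimir Dp).

Let DpE := @pauliE R theta e.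

Lemma pder_su2_span a b (ab1 : a * a^* + b * b^* = 1) e' (l : 'I_2) :
  exists c1 c2 : C, pder (su2 ab1) (zb e' l) = c1 *: zb e' 0 + c2 *: zb e' 1.
Proof.
have [E0 E1] := pder_su2 theta ab1 e'.
by case: (ord2P l) => ->; [rewrite E0|rewrite E1]; rewrite -(scaleNr _ (zb e' 1)); eexists; eexists.
Qed.

Lemma bgen_span k j : exists c1 c2 : C, Dp k (bgen j) = c1 *: bgen (j.1, 0) + c2 *: bgen (j.1, 1).
Proof.
have H l : exists c1 c2 : C, Dp k (zb e l) = c1 *: zb e 0 + c2 *: zb e 1.
  exact: (pder_su2_span (pauli_subproof R k) e l).
case: j => [[] l]; have [c1 [c2 E]] := H l; last by exists c1, c2.
exists (- c1^*), (- c2^*).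
by rewrite /bgen -!(zs_star theta false) [LHS]pder_star [pder _ _]E starD !starZ !scaleNr opprD.
Qed.

Lemma bgen_Dcomm k j l : Dp k (bgen j) * bgen l = bgen l * Dp k (bgen j).
Proof.
have [c1 [c2 ->]] := bgen_span k j.
by rewrite mulrDl mulrDr -!scalerAl -!scalerAr !(bgenC _ l).
Qed.

Lemma cross_bgen_sym j l : cross (bgen j) (bgen l) = cross (bgen l) (bgen j).
Proof.
apply: eq_bigr => k _; have [c1 [c2 E]] := bgen_span k l.
by rewrite E mulrDl mulrDr -!scalerAl -!scalerAr !bgen_Dcomm.
Qed.

Lemma cross_star f g : cross (star f) (star g) = star (cross g f).
Proof.
rewrite /Dcross star_sum; apply: eq_bigr => k _.
by rewrite /Dp !pder_star mulrNN starM.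
Qed.

(** The completeness relation makes the cross term diagonal modulo the squared
    norm, as required by the Casimir argument; the four cases are reduced to two
    by symmetry and by taking adjoints. *)
Lemma cross_bgen j l : exists c : C, cross (bgen j) (bgen l) = bgen j * bgen l + c *: hip e e.
Proof.
have main a b : (exists c : C, cross (zb e a) (zb e b) = zb e a * zb e b + c *: hip e e) /\
    (exists c : C, cross (zb e a) (star (zb e b)) = zb e a * star (zb e b) + c *: hip e e).
  have [D0x D0y D1x D1y [D2x D2y]] := DpE.
  have := zs_comm false false e 1 0; have := zs_comm true false e 0 0.
  have := zs_comm true false e 1 1; have := zs_comm true false e 1 0.
  have := zs_comm true false e 0 1.
  rewrite /Dcross !sum_ord3 /Dp !pder_star /hip sum_ord2.
  rewrite -![zs false _]/(zb _ _) -![zs true _]/(star (zb _ _)).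
  case: (ord2P a) => ->; case: (ord2P b) => ->; rewrite !(D0x, D0y, D1x, D1y, D2x, D2y);
    move: (zb e 0) (zb e 1) => x y Xy Yx Yy Xx yx.
  - by split; [exists 0; rewrite scale0r addr0; apply: pauli_xx|exists (-2); apply: pauli_xX].
  - by split; exists 0; rewrite scale0r addr0; [apply: pauli_xy|apply: pauli_xY].
  - by split; exists 0; rewrite scale0r addr0; [apply: pauli_yx|apply: pauli_yX].
  - by split; [exists 0; rewrite scale0r addr0; apply: pauli_yy|exists (-2); apply: pauli_yY].
have hS : star (hip e e) = hip e e.
  by rewrite /hip star_sum; apply: eq_bigr => k _; rewrite starM starK.
case: j l => [[] a] [[] b].
- have [[c E] _] := main b a; exists c^*.
  have := congr1 star E; rewrite -cross_star starD starM starZ hS => E'; exact: E'.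
- have [_ [c E]] := main b a; exists c.
  by rewrite cross_bgen_sym bgenC; exact: E.
- by have [_ [c E]] := main a b; exists c; exact: E.
- by have [[c E] _] := main a b; exists c; exact: E.
Qed.

Lemma casimir_bgen j : cas (bgen j) = 3 *: bgen j.
Proof.
have three (v : S7) : v + v + v = 3 *: v by rewrite scaler_nat !mulrS addrA addr0.
have main a : cas (zb e a) = 3 *: zb e a.
  have [D0x D0y D1x D1y [D2x D2y]] := DpE.
  rewrite /casimir sum_ord3 /Dp -three.
  case: (ord2P a) => ->; rewrite !(D0x, D0y, D1x, D1y, D2x, D2y, pderN, pderZ).
    by rewrite opprK scalerA mulrN -expr2 sqrCi opprK scale1r.
  by rewrite !opprK scalerA mulNr -expr2 sqrCi opprK scale1r.
case: j => [[] a]; last exact: main.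
have := congr1 star (main a); rewrite starZ rmorph_nat /casimir star_sum => E.
rewrite -[bgen _]/(star (zb e a)) -E; apply: eq_bigr => k _.
by rewrite /Dp !pder_star pderN pder_star opprK.
Qed.

(** Each factor from the other doublet costs one power of the squared norm of
    the doublet [e]. *)
Lemma pow_span f : exists N d, Aspan in_hopf bgen d (hip e e ^+ N * f).
Proof.
elim/S7_zs_ind: f => [|f g [N [d Hf]] [N' [d' Hg]]|c f [N [d Hf]]|b i f [N [d Hf]]].
- exists 0, 1; rewrite expr0; exact: (Aspan_term in_hopf1 (ltnSn 0) (gword0 _)).
- exists (N + N')%N, (maxn d d'); rewrite mulrDr; apply: Aspan_add.
    rewrite addnC exprD -mulrA; apply: (Aspan_mulA in_hopfM); first exact: in_hopf_hipX.
    by apply: Aspan_le Hf; rewrite leq_maxl.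
  rewrite exprD -mulrA; apply: (Aspan_mulA in_hopfM); first exact: in_hopf_hipX.
  by apply: Aspan_le Hg; rewrite leq_maxr.
- by exists N, d; rewrite -scalerAr; apply: (Aspan_scale in_hopf1 in_hopfM in_hopfZ).
have [e' [j ->]] := blkP i.
have [ee|ne] := eqVneq e' e.
  exists N, d.+1; rewrite ee mulrA -/(bgen (b, j)).
  have -> : hip e e ^+ N * bgen (b, j) = bgen (b, j) * hip e e ^+ N.
    by apply/esym/commrX; rewrite /GRing.comm hip_central.
  rewrite -mulrA; apply: Aspan_mulg Hf => k a Aa; exact: zs_in_hopf.
have {ne} -> : e' = ~~ e by case: (e) e' ne => [] [].
have [a1 [a2 [j1 [j2 [Aa1 Aa2 E]]]]] := hip_zs b j.
exists N.+1, d.+1; rewrite exprSr -mulrA [hip e e * _]mulrA E mulrDl mulrDr.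
have cX k a : hip e e ^+ N * (a * bgen k * f) = a * (bgen k * (hip e e ^+ N * f)).
  have cN x : hip e e ^+ N * x = x * hip e e ^+ N.
    by apply/esym/commrX; rewrite /GRing.comm hip_central.
  by rewrite mulrA cN -!mulrA cN.
rewrite !cX; apply: Aspan_add; apply: (Aspan_mulA in_hopfM) => //;
  apply: Aspan_mulg Hf => k a Aa; exact: zs_in_hopf.
Qed.

Lemma pow_in_hopf f : SU2_inv theta f -> exists N, in_hopf (hip e e ^+ N * f).
Proof.
move=> finv; have [N [d Hf]] := pow_span f; exists N.
have ginv : SU2_inv theta (hip e e ^+ N * f).
  by move=> w; rewrite rmorphM rmorphXn /= SU2_act_hip finv.
apply: (@casimir_ker _ _ in_hopf in_hopf1 in_hopfD in_hopfM in_hopfZ _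
  bgen (hip e e) (in_hopf_hip e e) bgenC _ _ Dp _ _ _ bgen_Dcomm cross_bgen casimir_bgen _ _ Hf).
- by move=> j a; apply: zs_in_hopf.
- by move=> k a b; apply: pderD.
- by move=> k a b; apply: pderM.
- by move=> k a Aa; apply/pder_inv/in_hopf_inv.
rewrite /casimir big1 // => k _; rewrite /Dp (pder_inv _ ginv).
by apply: pder_inv => w; rewrite rmorph0.
Qed.

End Block.

(** The squared norms of the two doublets add up to one, so the expansion of
    (p + q)^(N + M) f has only terms divisible by p^N f or by q^M f. *)
Lemma inv_in_hopf f : SU2_inv theta f -> in_hopf f.
Proof.
move=> finv; have [N HN] := pow_in_hopf false finv; have [M HM] := pow_in_hopf true finv.
have pq1 : hip false false + hip true true = 1 by rewrite -hpE -hqE hpq1.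
rewrite -[f]mul1r -(expr1n _ (N + M)) -pq1 exprDn_comm; last exact: hip_central.
rewrite mulr_suml; apply: (big_ind in_hopf) => [||i _].
- by exists 0; rewrite rmorph0.
- exact: in_hopfD.
rewrite mulrnAl -scaler_nat; apply: in_hopfZ.
have [Mi|iM] := leqP M i.
  by rewrite -(subnK Mi) exprD -!mulrA; do 2 apply: in_hopfM (in_hopf_hipX _ _) _.
have cX : GRing.comm (hip false false ^+ (N + M - i)) (hip true true ^+ i).
  by apply/commrX/commr_sym/commrX; exact: hip_central.
have le : (N <= N + M - i)%N by rewrite -addnBA ?leq_addr // ltnW.
rewrite cX -(subnK le) exprD -!mulrA; do 2 apply: in_hopfM (in_hopf_hipX _ _) _.
exact: HN.
Qed.

End Surjectivity.

(** * Representations of the 7-sphere on a lattice *)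

Section TorusModule.
Variables (R : realType) (theta : R).
Local Notation C := R[i].
Local Notation S7 := (S7 theta).
Local Notation mu := (mu theta).
Local Notation hopf := (@hopf R theta).
Local Notation V := (int * int -> C^o).
Variable c : 'I_4 -> C.

Definition sgb (b : bool) : int := if b then -1 else 1.

(** At a point [c] of the sphere, z_0 and z_1 act as multiples of a unitary U,
    z_2 and z_3 as multiples of a unitary V, where U V = mu V U; U and V are
    realized as weighted shifts of functions on the lattice of pairs of
    integers.  The coordinates [c i] may be complex, but the adjoint of z_i
    acts with the same factor [c i], so that the sphere relation becomes
    [\sum_i c i * c i = 1]. *)
Definition tor_op (b : bool) (i : 'I_4) (v : V) : V := fun k =>
  c i * (if (i < 2)%N then v (k.1 - sgb b, k.2)
         else mu ^ (- (sgb b * k.1)) * v (k.1, k.2 - sgb b)).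

Lemma tor_op_linear b i : linear (tor_op b i).
Proof.
move=> d v w; apply/funext => k; rewrite /tor_op.
change ((d *: tor_op b i v + tor_op b i w) k) with (d * tor_op b i v k + tor_op b i w k).
rewrite /tor_op; case: ifP => _.
  change ((d *: v + w) (k.1 - sgb b, k.2)) with (d * v (k.1 - sgb b, k.2) + w (k.1 - sgb b, k.2)).
  by rewrite mulrDr mulrCA.
change ((d *: v + w) (k.1, k.2 - sgb b)) with (d * v (k.1, k.2 - sgb b) + w (k.1, k.2 - sgb b)).
by rewrite !mulrDr [mu ^ _ * (d * _)]mulrCA [c i * (d * _)]mulrCA.
Qed.

Lemma tor_opZ b i (d : C) v : tor_op b i (d *: v) = d *: tor_op b i v.
Proof. exact: (mactZ tor_op_linear b (SGen i)). Qed.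

Let mu0 := mu_neq0 theta.

Lemma tor_op_comm b i b' j v : tor_op b i (tor_op b' j v) =
  (if (i < 2)%N == (j < 2)%N then 1
   else mu ^ (sgb b * sgb b' * (if (i < 2)%N then 1 else -1))) *: tor_op b' j (tor_op b i v).
Proof.
apply/funext => -[m n].
set d := (X in _ = (X *: _) _).
change ((d *: tor_op b' j (tor_op b i v)) (m, n)) with (d * tor_op b' j (tor_op b i v) (m, n)).
rewrite /d /tor_op /=; case: (i < 2)%N; case: (j < 2)%N => /=.
- by rewrite mul1r addrAC mulrCA.
- have -> : - (sgb b' * (m - sgb b)) = sgb b * sgb b' * 1 + - (sgb b' * m) by ring.
  rewrite expfzDr //; ring.
- have -> : - (sgb b * m) = sgb b * sgb b' * -1 + - (sgb b * (m - sgb b')) by ring.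
  rewrite expfzDr //; ring.
- rewrite mul1r addrAC; ring.
Qed.

Hypothesis c1 : \sum_i c i * c i = 1.

Lemma tor_op_sq b i v : tor_op b i (tor_op (~~ b) i v) = (c i * c i) *: v.
Proof.
apply/funext => -[m n]; change (((c i * c i) *: v) (m, n)) with (c i * c i * v (m, n)).
have s : sgb (~~ b) = - sgb b by case: b.
rewrite /tor_op /= s; case: (i < 2)%N; first by rewrite opprK subrK mulrA.
have AB : mu ^ (- (sgb b * m)) * mu ^ (- (- sgb b * m)) = 1.
  by rewrite -expfzDr // mulNr opprK addNr.
by rewrite opprK subrK [mu ^ _ * (c i * _)]mulrCA [mu ^ _ * (_ * v _)]mulrA AB mul1r mulrA.
Qed.

Lemma tor_op_respects : mrespects (@S7rel R theta) tor_op.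
Proof.
have muV : mu^* = mu ^ (-1) by rewrite -[RHS]mulr1 -(mu_unit theta) mulKf.
apply: S7_mrespects.
- exact: tor_op_linear.
- by move=> i j v; rewrite tor_op_comm lam'E /sgb; case: (i < 2)%N; case: (j < 2)%N; rewrite ?muV.
- by move=> i j v; rewrite tor_op_comm lam'E /sgb; case: (i < 2)%N; case: (j < 2)%N; rewrite ?muV.
- by move=> i j v; rewrite tor_op_comm lam'E /sgb; case: (i < 2)%N; case: (j < 2)%N; rewrite ?muV.
move=> v; under eq_bigr => i _ do rewrite (tor_op_sq false).
by rewrite -scaler_suml c1 scale1r.
Qed.

Definition tact (f : S7) : V -> V := pact tor_op (f : presented (@S7rel R theta)).

Lemma tactD f g v : tact (f + g) v = tact f v + tact g v.
Proof. exact: (pactDl tor_op_linear tor_op_respects). Qed.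
Lemma tactM f g v : tact (f * g) v = tact f (tact g v).
Proof. exact: (pactM tor_op_linear tor_op_respects). Qed.
Lemma tact1 v : tact 1 v = v.
Proof. exact: (pact1 tor_op_linear tor_op_respects). Qed.
Lemma tactZ (d : C) f v : tact (d *: f) v = d *: tact f v.
Proof. exact: (pactZl tor_op_linear tor_op_respects). Qed.
Lemma tactN f v : tact (- f) v = - tact f v.
Proof. by rewrite -scaleN1r tactZ scaleN1r. Qed.
Lemma tactZr f (d : C) v : tact f (d *: v) = d *: tact f v.
Proof. exact: (pactZr tor_op_linear). Qed.
Lemma tact_z i v : tact (S7z theta i) v = tor_op false i v.
Proof. exact: (pact_gen tor_op_linear tor_op_respects). Qed.
Lemma tact_s i v : tact (star (S7z theta i)) v = tor_op true i v.
Proof. exact: (pact_star_gen tor_op_linear tor_op_respects). Qed.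

Lemma tact_modsq i v : tact (modsq theta i) v = (c i * c i) *: v.
Proof. by rewrite tactM tact_s tact_z (tor_op_sq false). Qed.

Definition delta (k : int * int) : V := fun l => (l == k)%:R.

(** The shift of the support under [tor_op b i]. *)
Definition tdeg (b : bool) (i : 'I_4) : int * int :=
  if (i < 2)%N then (sgb b, 0) else (0, sgb b).

Definition online k (v : V) := exists2 d : C, d != 0 & v = d *: delta k.

Lemma tor_op_online b i k v : c i != 0 -> online k v -> online (k + tdeg b i) (tor_op b i v).
Proof.
move=> ci [d d0 ->].
rewrite tor_opZ.
rewrite /tdeg; case: k => k l; case: ifP => i2.
  exists (d * c i); rewrite ?mulf_neq0 // -scalerA; congr (_ *: _).
  apply/funext => -[m n]; rewrite /tor_op i2.
  change ((c i *: delta ((k, l) + (sgb b, 0))) (m, n)) with (c i * delta ((k, l) + (sgb b, 0)) (m, n)).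
  by congr (_ * _); rewrite /delta; congr (_%:R); rewrite !xpair_eqE addr0 subr_eq.
exists (d * (c i * mu ^ (- (sgb b * k)))); first by rewrite !mulf_neq0 // expfz_neq0.
rewrite -[RHS]scalerA; congr (_ *: _); apply/funext => -[m n]; rewrite /tor_op i2.
set d' := _ * mu ^ _.
change ((d' *: delta ((k, l) + (0, sgb b))) (m, n)) with
  (d' * delta ((k, l) + (0, sgb b)) (m, n)).
rewrite /d' -mulrA /delta; congr (_ * _); rewrite !xpair_eqE addr0 subr_eq.
by case: eqP => [->//|_]; rewrite !mulr0.
Qed.

(* With [c 1 = 0] each of [ha] and [hb] acts through one summand only, hence as
   a weighted shift. *)
Hypothesis c10 : c 1 = 0.

Lemma tor_op1 b v : tor_op b 1 v = (0 : C) *: v.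
Proof.
apply/funext => k; rewrite /tor_op c10 mul0r.
by change (((0 : C) *: v) k) with (0 * v k); rewrite mul0r.
Qed.

Lemma tact_ha v : tact (ha theta) v = tor_op false 0 (tor_op true 2 v).
Proof. by rewrite tactD !tactM !tact_s !tact_z tor_op1 scale0r addr0. Qed.
Lemma tact_sha v : tact (star (ha theta)) v = tor_op false 2 (tor_op true 0 v).
Proof.
rewrite star_ha tactD !tactM !tact_s !tact_z tor_op1.
by rewrite -(tact_z 3) tactZr scale0r addr0.
Qed.
Lemma tact_hb v : tact (hb theta) v = - tor_op false 0 (tor_op false 3 v).
Proof. by rewrite tactD tactN !tactM !tact_z tor_op1 scale0r addr0. Qed.
Lemma tact_shb v : tact (star (hb theta)) v = - tor_op true 3 (tor_op true 0 v).
Proof.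
rewrite star_hb tactD tactN !tactM !tact_s tor_op1.
by rewrite -(tact_s 2) tactZr scale0r addr0.
Qed.

Lemma tact_hb_sq v : tact (hb theta * star (hb theta)) v = (c 0 * c 0 * (c 3 * c 3)) *: v.
Proof.
rewrite tactM tact_shb tact_hb -[- tor_op true _ _]scaleN1r.
rewrite (tor_opZ false 3 (-1)) (tor_opZ false 0 (-1)) scaleN1r opprK.
rewrite (tor_op_sq false 3) (tor_opZ false 0 (c 3 * c 3)) (tor_op_sq false 0).
by rewrite scalerA mulrC.
Qed.

Lemma tact_hx v : tact (hp theta - hq theta) v = (c 0 * c 0 - c 2 * c 2 - c 3 * c 3) *: v.
Proof.
rewrite tactD tactN /hp /hq !tactD !tact_modsq c10 mul0r scale0r addr0.
by rewrite -scalerDl -scalerBl opprD addrA.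
Qed.

End TorusModule.

(** * Normal form in the 4-sphere *)

Section S4Monomials.
Variables (R : realType) (theta : R).
Local Notation C := R[i].
Local Notation S4 := (S4 theta).
Local Notation al := (S4alpha theta).
Local Notation be := (S4beta theta).
Local Notation xx := (S4coord theta).
Local Notation lam := (lam theta).

Lemma S4_relE t u : @S4rel R theta t u ->
  seval (fun g => pgen g : S4) t = seval (fun g => pgen g : S4) u.
Proof. by move=> tu; rewrite !S4_seval; apply/pclassP/sc_rel. Qed.

Lemma lam_unit : lam * lam^* = 1.
Proof. by rewrite lam_mu rmorphM mulrACA !mu_unit mulr1. Qed.

Lemma al_be : qcomm lam al be.
Proof. by have /= := S4_relE (S4_ab theta); rewrite -scalerAl mul1r. Qed.

Lemma al_sbe : qcomm lam^* al (star be).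
Proof. by have /= := S4_relE (S4_abs theta); rewrite -scalerAl mul1r. Qed.

Lemma al_normal : al * star al = star al * al.
Proof. exact: S4_relE (S4_a_normal theta). Qed.

Lemma be_normal : be * star be = star be * be.
Proof. exact: S4_relE (S4_b_normal theta). Qed.

Lemma xx_central a : xx * a = a * xx.
Proof.
by elim/pclass_ind: a => t; rewrite -S4_seval; exact: S4_relE (S4_x_central theta t).
Qed.

Lemma S4_sphereE : al * star al = 1 - be * star be - xx * xx.
Proof.
have /= := S4_relE (S4_sphere theta); rewrite scale1r => <-.
by rewrite -!addrA (AC (1*(1*(1*(1*1)))) (1*((2*4)*(3*5)))) /= !subrr !addr0.
Qed.

Lemma lamC_unit : lam^* * lam = 1. Proof. by rewrite mulrC lam_unit. Qed.

Lemma be_al : qcomm lam^* be al.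
Proof. exact: qcomm_sym lamC_unit al_be. Qed.

Lemma be_sal : qcomm lam be (star al).
Proof. by have /qcomm_star := al_sbe; rewrite starK conjCK. Qed.

Lemma sbe_al : qcomm lam (star be) al.
Proof. exact: qcomm_sym lam_unit al_sbe. Qed.

Lemma sbe_sal : qcomm lam^* (star be) (star al).
Proof. exact: qcomm_star al_be. Qed.

(** Together with x, this element generates a central subalgebra; the sphere
    relation expresses alpha alpha^* through them. *)
Definition bb : S4 := be * star be.

Lemma bb_central a : bb * a = a * bb.
Proof.
have bal : bb * al = al * bb.
  by apply/qcomm1; rewrite -lamC_unit; apply: qcommMl be_al sbe_al.
have bsal : bb * star al = star al * bb.
  by apply/qcomm1; rewrite -lam_unit; apply: qcommMl be_sal sbe_sal.
elim/S4_word_ind: a => [|a b Pa Pb|c a Pa|g a Pa|g a Pa].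
- by rewrite mulr1 mul1r.
- by rewrite mulrDl mulrDr Pa Pb.
- by rewrite -scalerAl -scalerAr Pa.
- rewrite mulrA -[RHS]mulrA -Pa [RHS]mulrA; congr (_ * _).
  by case: g; [exact: bal|rewrite /bb -[LHS]mulrA -be_normal|rewrite -xx_central].
rewrite mulrA -[RHS]mulrA -Pa [RHS]mulrA; congr (_ * _).
case: g; [exact: bsal|by rewrite /bb [RHS]mulrA -be_normal|].
by have /= <- := S4_relE (S4_x_self theta); rewrite -xx_central.
Qed.

Lemma evb_commr : commr_rmorph (horner_alg bb) xx.
Proof. by move=> p; exact: xx_central. Qed.

(** Polynomials in the two central elements: the outer variable is x, the inner
    one is [bb]. *)
Definition ev : {poly {poly C}} -> S4 := horner_morph evb_commr.

HB.instance Definition _ := GRing.RMorphism.on ev.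

Lemma evX : ev 'X = xx. Proof. exact: horner_morphX. Qed.
Lemma evXC : ev 'X%:P = bb.
Proof. by rewrite /ev horner_morphC /= horner_algX. Qed.
Lemma evC c : ev c%:P%:P = c%:A.
Proof. by rewrite /ev horner_morphC /= horner_algC. Qed.

Lemma poly2_ind (Q : {poly {poly C}} -> Prop) :
  (forall c, Q c%:P%:P) -> Q 'X -> Q 'X%:P ->
  (forall p q, Q p -> Q q -> Q (p + q)) -> (forall p q, Q p -> Q q -> Q (p * q)) ->
  forall p, Q p.
Proof.
move=> QC QX QY QD QM p; elim/poly_ind: p => [|p c Qp]; first exact: (QC 0).
apply: (QD); first exact: QM.
elim/poly_ind: c => [|c d Qc]; first exact: (QC 0).
by rewrite polyCD polyCM; apply: QD => //; apply: QM.
Qed.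

Lemma ev_central p a : ev p * a = a * ev p.
Proof.
elim/poly2_ind: p => [c|||p q Hp Hq|p q Hp Hq].
- by rewrite evC -scalerAl -scalerAr mul1r mulr1.
- by rewrite evX xx_central.
- by rewrite evXC bb_central.
- by rewrite rmorphD mulrDl mulrDr Hp Hq.
by rewrite rmorphM -mulrA Hq mulrA Hp mulrA.
Qed.

(** Negative powers are powers of the adjoint. *)
Definition zpow (a : S4) (n : int) : S4 :=
  match n with Posz k => a ^+ k | Negz k => star a ^+ k.+1 end.

Lemma zpow_mul (a : S4) n : a * zpow a n = zpow a (n + 1) \/
  a * zpow a n = (a * star a) * zpow a (n + 1).
Proof.
case: n => [n|[|n]] /=.
- by left; rewrite addn1 exprS.
- by right; rewrite expr1 mulr1.
by right; rewrite exprS mulrA subn1.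
Qed.

Lemma zpow_smul (a : S4) n : a * star a = star a * a ->
  star a * zpow a n = zpow a (n - 1) \/
  star a * zpow a n = (a * star a) * zpow a (n - 1).
Proof.
move=> aN; case: n => [[|n]|n] /=.
- by left; rewrite mulr1 expr1.
- by right; rewrite exprS mulrA aN /= subn1.
by left; rewrite -exprS addn0.
Qed.

Definition monom (k : int * int) : S4 := zpow al k.1 * zpow be k.2.

(** Bidegree: alpha has degree (1, 0) and beta has degree (0, 1).  The elements of
    a given bidegree form a module of rank one over the central subalgebra
    generated by x and [bb]; this makes polynomial identities applicable to
    them. *)
Definition S4hom (k : int * int) (a : S4) := exists p, a = monom k * ev p.

Lemma S4hom0 k : S4hom k 0.
Proof. by exists 0; rewrite rmorph0 mulr0. Qed.

Lemma S4homD k a b : S4hom k a -> S4hom k b -> S4hom k (a + b).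
Proof. by move=> [p ->] [q ->]; exists (p + q); rewrite rmorphD mulrDr. Qed.

Lemma S4homZ k (c : C) a : S4hom k a -> S4hom k (c *: a).
Proof.
move=> [p ->]; exists (c%:P%:P * p).
by rewrite rmorphM /= evC -scalerAl mul1r scalerAr.
Qed.

Lemma S4hom_ev k p a : S4hom k a -> S4hom k (ev p * a).
Proof. by move=> [q ->]; exists (p * q); rewrite rmorphM mulrA ev_central -!mulrA. Qed.

Lemma ev_al : ev (1 - 'X%:P - 'X * 'X) = al * star al.
Proof. by rewrite S4_sphereE !rmorphB rmorph1 rmorphM /= evX evXC. Qed.

Lemma S4hom_al k a : S4hom k a -> S4hom (k + (1, 0)) (al * a).
Proof.
case: k => n m [p ->]; rewrite /monom /= !mulrA.
have [->|->] := zpow_mul al n; first by exists p; rewrite /monom /= addr0 ?mulrA.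
by rewrite -ev_al -!mulrA; apply: S4hom_ev; exists p; rewrite /monom /= addr0 !mulrA.
Qed.

Lemma S4hom_sal k a : S4hom k a -> S4hom (k - (1, 0)) (star al * a).
Proof.
case: k => n m [p ->]; rewrite /monom /= !mulrA.
have [->|->] := zpow_smul n al_normal; first by exists p; rewrite /monom /= subr0 ?mulrA.
by rewrite -ev_al -!mulrA; apply: S4hom_ev; exists p; rewrite /monom /= subr0 !mulrA.
Qed.

Lemma qcomm_zpow c c' (b : S4) n : qcomm c b al -> qcomm c' b (star al) ->
  exists d, qcomm d b (zpow al n).
Proof.
have pw e (x : S4) j : qcomm e b x -> exists d, qcomm d b (x ^+ j).
  move=> bx; elim: j => [|j [d IH]]; first by exists 1; apply/qcomm1; rewrite mulr1 mul1r.
  by exists (e * d); rewrite exprS; apply: qcommMr.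
by move=> b1 b2; case: n => n /=; [apply: pw b1|apply: pw b2].
Qed.

Lemma S4hom_be k a : S4hom k a -> S4hom (k + (0, 1)) (be * a).
Proof.
case: k => n m [p ->]; rewrite /monom /= !mulrA.
have [d ->] := qcomm_zpow n be_al be_sal.
rewrite -!scalerAl; apply: S4homZ; rewrite -!mulrA [be * (_ * _)]mulrA.
have [->|->] := zpow_mul be m; first by exists p; rewrite /monom /= addr0 ?mulrA.
rewrite -[be * star be]/bb -evXC !mulrA -(ev_central 'X%:P (zpow al n)) -!mulrA; apply: S4hom_ev.
by exists p; rewrite /monom /= addr0 !mulrA.
Qed.

Lemma S4hom_sbe k a : S4hom k a -> S4hom (k - (0, 1)) (star be * a).
Proof.
case: k => n m [p ->]; rewrite /monom /= !mulrA.
have [d ->] := qcomm_zpow n sbe_al sbe_sal.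
rewrite -!scalerAl; apply: S4homZ; rewrite -!mulrA [star be * (_ * _)]mulrA.
have [->|->] := zpow_smul m be_normal; first by exists p; rewrite /monom /= subr0 ?mulrA.
rewrite -[be * star be]/bb -evXC !mulrA -(ev_central 'X%:P (zpow al n)) -!mulrA; apply: S4hom_ev.
by exists p; rewrite /monom /= subr0 !mulrA.
Qed.

Lemma S4hom_gen b g : exists d, forall k a, S4hom k a ->
  S4hom (k + d) ((if b then star (pgen g : S4) else pgen g) * a).
Proof.
have xh k a : S4hom k a -> S4hom (k + 0) (xx * a).
  by rewrite addr0 -evX; apply: S4hom_ev.
case: g b => [] [].
- by exists (- (1, 0)) => k a; apply: S4hom_sal.
- by exists (1, 0) => k a; apply: S4hom_al.
- by exists (- (0, 1)) => k a; apply: S4hom_sbe.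
- by exists (0, 1) => k a; apply: S4hom_be.
- by exists 0; have /= <- := S4_relE (S4_x_self theta).
- by exists 0.
Qed.

(** The sphere relation trades each product of alpha and its adjoint for a
    polynomial in x and [bb], and similarly for beta; so multiplication by a
    generator shifts the bidegree. *)
Lemma S4_gsum a : exists L, gsum S4hom L a.
Proof.
have step b g x : (exists L, gsum S4hom L x) ->
    exists L, gsum S4hom L ((if b then star (pgen g : S4) else pgen g) * x).
  move=> [L Lx]; have [d hd] := S4hom_gen b g; exists [seq k + d | k <- L].
  by apply: gsum_map Lx; [exact: mulr0|exact: mulrDr|exact: hd].
elim/S4_word_ind: a => [|a b|c a [L La]|g a|g a].
- exists [:: 0]; apply: (gsum_hom (k := 0)) => //.
  by exists 1; rewrite rmorph1 /monom /= !mulr1.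
- exact: gsumD_exists.
- exists (map id L); apply: gsum_map La; [exact: scaler0|exact: scalerDr|].
  by move=> k v; apply: S4homZ.
- exact: (step false).
exact: (step true).
Qed.

End S4Monomials.

(** * Injectivity *)

(** The shift of the lattice produced by the images of alpha and beta, which are
    multiples of U V^-1 and of U V. *)
Definition S4deg (g : S4gen) : int * int :=
  match g with S4a => (1, -1) | S4b => (1, 1) | S4x => 0 end.

Section TorusPoint.
Variables (R : realType) (theta : R).
Local Notation C := R[i].
Local Notation S4 := (S4 theta).
Local Notation al := (S4alpha theta).
Local Notation be := (S4beta theta).
Local Notation hopf := (@hopf R theta).
Variable c : 'I_4 -> C.
Hypothesis c1 : \sum_i c i * c i = 1.
Hypothesis c10 : c 1 = 0.
Hypotheses (c0n : c 0 != 0) (c2n : c 2 != 0) (c3n : c 3 != 0).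
Local Notation tact := (@tact R theta c).
Local Notation online := (@online R).

Lemma onlineZ (d : C) k v : d != 0 -> online k v -> online k (d *: v).
Proof. by move=> d0 [e e0 ->]; exists (d * e); [rewrite mulf_neq0|rewrite scalerA]. Qed.

Lemma onlineN k v : online k v -> online k (- v).
Proof. by move=> kv; rewrite -scaleN1r; apply: onlineZ kv; rewrite oppr_eq0 oner_eq0. Qed.

Let two : (2 : C) != 0. Proof. by rewrite pnatr_eq0. Qed.

Lemma tact_hopf_gen b g (k : int * int) v : g <> S4x -> online k v ->
  online (k + S4deg g *~ sgb b)
         (tact (hopf (if b then star (pgen g : S4) else pgen g)) v).
Proof.
move=> gx kv; case: g gx => // _.
  case: b; rewrite ?hopf_star hopf_genE /= ?starZ ?rmorph_nat tactZ //; apply: onlineZ => //.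
    rewrite tact_sha //; have := tor_op_online theta false c2n (tor_op_online theta true c0n kv).
    by rewrite -addrA.
  rewrite tact_ha //; have := tor_op_online theta false c0n (tor_op_online theta true c2n kv).
  by rewrite -addrA.
case: b; rewrite ?hopf_star hopf_genE /= ?starZ ?rmorph_nat tactZ //; apply: onlineZ => //.
  rewrite tact_shb //; apply: onlineN.
  have := tor_op_online theta true c3n (tor_op_online theta true c0n kv).
  by rewrite -addrA.
rewrite tact_hb //; apply: onlineN.
have := tor_op_online theta false c0n (tor_op_online theta false c3n kv).
by rewrite -addrA.
Qed.

Lemma tact_zpow g n k v : g <> S4x -> online k v ->
  online (k + S4deg g *~ n) (tact (hopf (zpow (pgen g) n)) v).
Proof.
move=> gx kv.
have pw b j : online (k + S4deg g *~ (sgb b * j%:Z))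
    (tact (hopf ((if b then star (pgen g : S4) else pgen g) ^+ j)) v).
  elim: j => [|j IH]; first by rewrite mulr0 mulr0z addr0 rmorph1 tact1.
  rewrite exprS rmorphM tactM //; have := tact_hopf_gen b gx IH.
  by rewrite -addrA -mulrzDr intS mulrDr mulr1 [sgb b + _]addrC.
case: n => j /=; first by have := pw false j; rewrite mul1r.
by have := pw true j.+1; rewrite mulN1r -NegzE.
Qed.

Definition lattice_pt (k : int * int) : int * int := S4deg S4a *~ k.1 + S4deg S4b *~ k.2.

Lemma tact_monom k v : online 0 v -> online (lattice_pt k) (tact (hopf (monom theta k)) v).
Proof.
move=> v0; rewrite /monom rmorphM tactM //.
have := tact_zpow (g := S4a) k.1 _ (tact_zpow (g := S4b) k.2 _ v0).
by rewrite add0r [_ *~ k.2 + _]addrC; apply.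
Qed.

Let x0 := c 0 * c 0 - c 2 * c 2 - c 3 * c 3.
Let b0 := 2 * 2 * (c 0 * c 0 * (c 3 * c 3)).

Lemma tact_ev p v : tact (hopf (ev theta p)) v = p.[x0%:P].[b0] *: v.
Proof.
elim/poly2_ind: p v => [d|||p q Hp Hq|p q Hp Hq] v.
- by rewrite evC linearZ /= rmorph1 tactZ // tact1 // !hornerC.
- by rewrite evX hornerX hornerC hopf_genE tact_hx.
- rewrite evXC hornerC hornerX rmorphM /= hopf_star hopf_genE /= starZ rmorph_nat.
  by rewrite -scalerAl -scalerAr scalerA tactZ // tact_hb_sq // scalerA.
- by rewrite [ev theta _]rmorphD [hopf _]rmorphD tactD // Hp Hq !hornerD scalerDl.
by rewrite [ev theta _]rmorphM [hopf _]rmorphM tactM // Hq Hp !hornerM scalerA.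
Qed.

(** Distinct bidegrees move the origin to distinct lattice points, and the
    polynomial coefficient appears evaluated at the point, up to a nonzero
    factor. *)
Lemma tact_hom k p : exists2 d : C, d != 0 &
  tact (hopf (monom theta k * ev theta p)) (delta R 0) =
  (p.[x0%:P].[b0] * d) *: delta R (lattice_pt k).
Proof.
have d0 : online 0 (delta R 0) by exists 1; rewrite ?oner_eq0 ?scale1r.
have [d dn E] := tact_monom k d0; exists d => //.
by rewrite rmorphM /= tactM // tact_ev tactZr E scalerA.
Qed.

End TorusPoint.

Lemma lattice_pt_inj : injective lattice_pt.
Proof.
have mn (a b : int) j : (a, b) *+ j = (a *+ j, b *+ j).
  by elim: j => [|j IH]; rewrite ?mulr0n // !mulrS IH.
have mz (a b n : int) : (a, b) *~ n = (a * n, b * n).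
  by rewrite -!mulrzz; case: n => j; rewrite ?NegzE ?mulrNz -!pmulrn mn.
move=> [n m] [n' m']; rewrite /lattice_pt /= !mz => -[]; rewrite !mul1r !mulN1r.
by move=> e1 e2; congr (_, _); lia.
Qed.

Lemma poly_many_roots (D : idomainType) (p : {poly D}) (f : nat -> D) :
  injective f -> (forall n, root p (f n)) -> p = 0.
Proof.
move=> finj pf; apply: (@roots_geq_poly_eq0 _ p [seq f i | i <- iota 0 (size p)]).
- by apply/allP => x /mapP[i _ ->].
- by rewrite map_inj_uniq ?iota_uniq.
by rewrite size_map size_iota.
Qed.

Section Injectivity.
Variables (R : realType) (theta : R).
Local Notation C := R[i].
Local Notation S4 := (S4 theta).
Local Notation hopf := (@hopf R theta).

Definition good_pt (c : 'I_4 -> C) :=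
  [/\ \sum_i c i * c i = 1, c 1 = 0 & [/\ c 0 != 0, c 2 != 0 & c 3 != 0]].

Lemma good_pt_exists (s t : C) : s != 0 -> t != 0 -> s + t != 1 ->
  exists2 c, good_pt c & c 0 * c 0 = s /\ c 3 * c 3 = t.
Proof.
move=> s0 t0 st; have r0 : 1 - s - t != 0 by rewrite -addrA -opprD subr_eq0 eq_sym.
pose c (i : 'I_4) : C := if i == 0 then sqrtC s else if i == 1 then 0
  else if i == 2 then sqrtC (1 - s - t) else sqrtC t.
have sq (u : C) : sqrtC u * sqrtC u = u by rewrite -expr2 sqrtCK.
exists c; last by rewrite /c /= !sq.
split=> //; last by rewrite /c /= !sqrtC_eq0.
rewrite sum_ord4 /c /= !sq mul0r addr0.
by ring.
Qed.

(** With s = c_0^2 and t = c_3^2 the evaluation point is (2 s - 1, 4 s t).  The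
    values s = n + 2 and t = m + 1 are allowed, since then s + t differs from 1;
    they give infinitely many t for each s, and infinitely many s. *)
Lemma ev_points_eq0 (p : {poly {poly C}}) :
  (forall c, good_pt c ->
    p.[(c 0 * c 0 - c 2 * c 2 - c 3 * c 3)%:P].[2 * 2 * (c 0 * c 0 * (c 3 * c 3))] = 0) ->
  p = 0.
Proof.
move=> Hp.
have nat_inj (a b : C) : a != 0 -> injective (fun n : nat => a * n%:R + b).
  by move=> a0 m n /addIr /(mulfI a0) /eqP; rewrite eqr_nat => /eqP.
have two : (2 : C) != 0 by rewrite pnatr_eq0.
apply: (@poly_many_roots _ p (fun n => ((2 * n%:R + 3%:R) : C)%:P)).
  by move=> m n /polyC_inj /(nat_inj _ _ two).
move=> n; apply/eqP; pose s : C := n.+2%:R.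
have s0 : s != 0 by rewrite pnatr_eq0.
apply: (@poly_many_roots _ _ (fun m => (2 * 2 * s) * m%:R + 2 * 2 * s)).
  by apply: nat_inj; rewrite !mulf_neq0.
move=> m; pose t : C := m.+1%:R.
have t0 : t != 0 by rewrite pnatr_eq0.
have st : s + t != 1 by rewrite /s /t -natrD pnatr_eq1 addSn addnS.
have [c gc [cs ct]] := good_pt_exists s0 t0 st; have := Hp _ gc.
have c2 : c 2 * c 2 = 1 - s - t.
  case: gc => + c1 _; rewrite sum_ord4 c1 mul0r addr0 cs ct => <-.
  by ring.
rewrite c2 cs ct => H; apply/eqP; rewrite -[RHS]H; congr (_.[_%:P].[_]).
  by rewrite /s -[n.+2]addn2 natrD; ring.
by rewrite /t -[m.+1]addn1 natrD; ring.
Qed.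

(** If the image of [a] vanishes, then for each bidegree [k] the coefficient of
    the image of the origin at the corresponding lattice point vanishes for all
    points of the sphere, hence so does the part of [a] of bidegree [k].
    Removing duplicates from the list of degrees ensures that no other term
    contributes. *)
Lemma hopf_inj : injective hopf.
Proof.
suff ker a : hopf a = 0 -> a = 0.
  by move=> a b ab; apply/subr0_eq/ker; rewrite rmorphB /= ab subrr.
have [L La] := S4_gsum a.
have {La} : gsum (S4hom (theta := theta)) (undup L) a.
  by apply: gsum_sub La => k; rewrite mem_undup.
elim: (undup L) (undup_uniq L) a => [_|k {}L IH /= /andP[kL Lu]] a aL a0; first by inversion aL.
have [v [g [[p vE] gL aE]]] := gsum_cons (@S4hom0 R theta) (@S4homD R theta) aL.
suff p0 : p = 0.
  by rewrite aE vE p0 rmorph0 mulr0 add0r in a0 *; apply: IH.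
apply: ev_points_eq0 => c [c1 c10 [c0 c2 c3]].
have scE (d : C) (w : int * int -> C^o) l : (d *: w) l = d * w l by [].
have addE (w w' : int * int -> C^o) l : (w + w') l = w l + w' l by [].
have at_k (w : S4) : gsum (S4hom (theta := theta)) L w ->
    tact c (hopf w) (delta R 0) (lattice_pt k) = 0.
  elim=> [|k' u f k'L [q ->] _ IHf].
    by rewrite rmorph0 -(scale0r (0 : S7 theta)) tactZ // scE mul0r.
  rewrite rmorphD tactD // addE IHf addr0.
  have [d _ ->] := tact_hom theta c1 c10 c0 c2 c3 k' q; rewrite scE /delta.
  case: eqP => [/lattice_pt_inj kk|_]; last by rewrite mulr0.
  by rewrite kk k'L in kL.
have : tact c (hopf (v + g)) (delta R 0) (lattice_pt k) = 0.
  by rewrite -aE a0 -(scale0r (0 : S7 theta)) tactZ // scE mul0r.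
rewrite rmorphD /= tactD // addE (at_k _ gL) addr0 vE.
have [d dn ->] := tact_hom theta c1 c10 c0 c2 c3 k p; rewrite scE /delta eqxx mulr1 => /eqP.
by rewrite mulf_eq0 (negPf dn) orbF => /eqP.
Qed.

End Injectivity.

Theorem mainTheorem1 (R : realType) (theta : R) :
  exists phi : {lrmorphism S4 theta -> S7 theta},
    [/\ let z := S7z theta in
        [/\ phi (S4alpha theta) = 2 *: (z 0 * star (z 2) + z 1 * star (z 3)),
            phi (S4beta theta) = 2 *: (- (z 0 * z 3) + z 1 * z 2) &
            phi (S4coord theta) =
              z 0 * star (z 0) + z 1 * star (z 1)
              - z 2 * star (z 2) - z 3 * star (z 3)],
        {morph phi : a / star a},
        injective phi &
        range phi = SU2_inv theta].
Proof.
exists (@hopf R theta); split.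
- by split; rewrite [LHS]hopf_genE // /= /hp /hq opprD addrA.
- exact: hopf_star.
- exact: hopf_inj.
apply/seteqP; split=> [_ [a _ <-]|f finv]; first by move=> w; apply: SU2_act_hopf.
by have [a ->] := inv_in_hopf finv; exists a.
Qed.
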